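(* The set $\mathrm{WPic}_{\mathbb{Z}\langle G\rangle}$ is an abelian group, with group operation defined by $[L]\cdot[M]=[L\otimes_{\mathbb{Z}\langle G\rangle}M]$, with identity element $[\mathbb{Z}\langle G\rangle]$, and with $[L]^{-1}=[\bar L]$.
   Context: Let $G$ be a finite abelian group with a fixed element $u$ of order $2$, $n=\#G/2$, $\mathbb{Z}\langle G\rangle=\mathbb{Z}[G]/(u+1)$, $t(\sum a_\sigma\sigma)=a_1-a_u$, $\overline{\sum a_\sigma\sigma}=\sum a_\sigma\sigma^{-1}$. A $G$-lattice is a lattice (finitely generated abelian group with bilinear symmetric positive definite $\mathbb{Z}$-valued form) with a homomorphism from $G$ to its form-preserving automorphisms in which $u$ acts as $-1$; $G$-isomorphisms are form-preserving group isomorphisms commuting with the actions. $L$ is invertible if it has rank $n$, Gram determinant $1$, and for every $m\in\mathbb{Z}_{>0}$ some $e_m\in L$ has $\{\sigma e_m+mL:\sigma\in G\}$ generating $L/mL$. $\bar L$ is a copy of $L$ via $x\mapsto\bar x$ with action $\sigma\bar x=\overline{\sigma^{-1}x}$; lifted inner product $x\cdot\bar y=\sum_{\sigma\in S}\langle x,\sigma y\rangle\sigma$ ($S$ coset representatives of $G/\langle u\rangle$). The standard $G$-lattice $\mathbb{Z}\langle G\rangle$ has $\langle x,y\rangle=t(x\bar y)$. For invertible $L,M$, $L\otimes_{\mathbb{Z}\langle G\rangle}M$ is the $G$-lattice with inner product $t(a\cdot\bar b)$, where $(x\otimes v)\cdot(\bar y\otimes\bar w)=(x\cdot\bar y)(v\cdot\bar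 w)$. $\mathrm{WPic}_{\mathbb{Z}\langle G\rangle}=\{[L]: L \text{ an invertible } G\text{-lattice}\}$, where $[L]=[M]$ iff $L$ and $M$ are $G$-isomorphic. *)

(* Defs.v *)
From HB Require Import structures.
From mathcomp Require Import all_boot all_order all_fingroup all_algebra.
From mathcomp Require Import boolp.
From mathcomp Require Import freeg.

Set Implicit Arguments.
Unset Strict Implicit.
Unset Printing Implicit Defensive.

Import Order.TTheory GRing.Theory Num.Theory.
Local Open Scope ring_scope.
Local Open Scope quotient_scope.

(* The commutativity proof is a parameter so that the alias can carry the
   commutative ring structure (convolution, not the pointwise product). *)
Definition group_ring (gT : finGroupType) (_ : abelian [set: gT]) : Type :=
  {ffun gT -> int}.

Section GroupRing.
Variables (gT : finGroupType) (cG : abelian [set: gT]).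
Local Notation ZG := (group_ring cG).

HB.instance Definition _ := GRing.Zmodule.copy ZG {ffun gT -> int}.

Definition gr_of (s : gT) : ZG := [ffun x => (x == s)%:R].

Definition gr_mul (a b : ZG) : ZG :=
  [ffun s : gT => \sum_(x : gT) a x * b (x^-1 * s)%g].

Lemma abelian_mulgC (x y : gT) : (x * y = y * x)%g.
Proof. exact: (centsP cG). Qed.

Lemma gr_mulC : commutative gr_mul.
Proof.
move=> a b; apply/ffunP=> s; rewrite !ffunE.
rewrite (reindex_inj (h := fun x => (x^-1 * s)%g)) /=; last first.
  by move=> x y /mulIg /invg_inj.
apply: eq_bigr => x _; rewrite mulrC; congr (b _ * a _).
by rewrite invMg invgK -mulgA [(x * s)%g]abelian_mulgC mulKg.
Qed.

Lemma gr_mulA : associative gr_mul.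
Proof.
move=> a b c; apply/ffunP=> s; rewrite !ffunE.
transitivity (\sum_x \sum_y a x * (b y * c (y^-1 * (x^-1 * s))%g)).
  by apply: eq_bigr => x _; rewrite ffunE mulr_sumr.
under [RHS]eq_bigr => y _ do rewrite ffunE mulr_suml.
rewrite [RHS]exchange_big /=; apply: eq_bigr => x _.
rewrite [RHS](reindex_inj (mulgI x)) /=; apply: eq_bigr => y _.
by rewrite mulKg invMg -mulgA mulrA.
Qed.

Lemma gr_mulE s (a : ZG) x : gr_mul (gr_of s) a x = a (s^-1 * x)%g.
Proof.
rewrite ffunE (bigD1 s) //= big1 => [|y /negbTE ney].
  by rewrite ffunE eqxx mul1r addr0.
by rewrite ffunE ney mul0r.
Qed.

Lemma gr_mul1 : left_id (gr_of 1%g) gr_mul.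
Proof. by move=> a; apply/ffunP=> s; rewrite gr_mulE invg1 mul1g. Qed.

Lemma gr_mulDl : left_distributive gr_mul +%R.
Proof.
move=> a b c; apply/ffunP=> s; rewrite !ffunE -big_split /=.
by apply: eq_bigr => x _; rewrite ffunE mulrDl.
Qed.

Lemma gr_one_neq0 : gr_of 1%g != 0.
Proof. by apply/eqP=> /ffunP/(_ 1%g); rewrite !ffunE eqxx. Qed.

HB.instance Definition _ := GRing.Zmodule_isComNzRing.Build ZG
  gr_mulA gr_mulC gr_mul1 gr_mulDl gr_one_neq0.

Definition gr_bar (a : ZG) : ZG := [ffun s : gT => a s^-1%g].

Definition gr_t (u : gT) (a : ZG) : int := a 1%g - a u.

End GroupRing.

Section ModifiedGroupRing.
Variables (gT : finGroupType) (cG : abelian [set: gT]).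
Variables (u : gT) (ou : #[u]%g = 2%N).
Local Notation ZG := (group_ring cG).

(* The principal ideal (u + 1); the proof [ou] is a parameter because
   [{ideal_quot _}] requires the ideal to be proper. *)
Definition u1_ideal (_ : #[u]%g = 2%N) : {pred ZG} :=
  fun a => `[< exists b : ZG, a = b * (gr_of cG u + 1) >].

Lemma mulguu : (u * u = 1)%g.
Proof. by have := expg_order u; rewrite ou expgS expg1. Qed.

Lemma gr_mulu1E (b : ZG) s : (b * (gr_of cG u + 1)) s = b (u * s)%g + b s.
Proof.
have u1 : u^-1%g = u by apply/eqP; rewrite eq_invg_mul mulguu.
by rewrite mulrDr mulr1 mulrC ffunE [_ * _]/(gr_mul _ _) gr_mulE u1.
Qed.

Lemma gr_t_u1 (b : ZG) : gr_t u (b * (gr_of cG u + 1)) = 0.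
Proof.
rewrite /gr_t !gr_mulu1E mulg1 mulguu.
by rewrite [X in X - _]addrC subrr.
Qed.

Lemma gr_t1 : gr_t u (1 : ZG) = 1.
Proof.
have /negbTE u1 : u != 1%g by rewrite -order_gt1 ou.
by rewrite /gr_t !ffunE eqxx u1.
Qed.

Lemma u1_ideal_closed : idealr_closed (u1_ideal ou).
Proof.
split.
- by apply/asboolP; exists 0; rewrite mul0r.
- by apply/asboolP => -[b b1]; have := gr_t1; rewrite b1 gr_t_u1.
move=> a x y /asboolP[b ->] /asboolP[c ->]; apply/asboolP.
by exists (a * b + c); rewrite mulrDl mulrA.
Qed.

HB.instance Definition _ := isIdealr.Build ZG (u1_ideal ou) u1_ideal_closed.

Definition zg : Type := {ideal_quot (u1_ideal ou)}.
HB.instance Definition _ := GRing.ComNzRing.on zg.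
HB.instance Definition _ := Quotient.on zg.

(* [zg_t], [zg_bar], and further down [zg_act] and [gtensor], are computed on
   chosen representatives; their independence of the choice is proved in
   section WellDefined at the end of the file. *)
Definition zg_of (s : gT) : zg := \pi_zg (gr_of cG s).
Definition zg_t (r : zg) : int := gr_t u (generic_quotient.repr r : ZG).
Definition zg_bar (r : zg) : zg := \pi_zg (gr_bar (generic_quotient.repr r : ZG)).

End ModifiedGroupRing.

Section GeneratedSubgroup.
Variables (V : zmodType) (A : V -> Prop).

Definition gensub : {pred V} := fun v =>
  `[< forall S : {pred V}, zmod_closed S -> (forall a, A a -> a \in S) ->
        v \in S >].

Lemma gensub_closed : zmod_closed gensub.
Proof.
split; first by apply/asboolP => S [].
move=> x y /asboolP Ax /asboolP Ay; apply/asboolP => S clS AS.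
by case: (clS) => _; apply; [exact: Ax | exact: Ay].
Qed.

HB.instance Definition _ := GRing.isZmodClosed.Build V gensub gensub_closed.

End GeneratedSubgroup.

(* The data underlying a G-lattice, without axioms. *)
Record gdata (gT : finGroupType) := GData {
  gcarrier :> zmodType;
  glform : gcarrier -> gcarrier -> int;
  glact : gT -> gcarrier -> gcarrier
}.

Section GLattice.
Variables (gT : finGroupType) (u : gT).
Implicit Types L M : gdata gT.

Definition lincomb (V : zmodType) (I : finType) (b : I -> V)
  (c : {ffun I -> int}) : V := \sum_i b i *~ c i.

Definition fin_gen (V : zmodType) : Prop :=
  exists (k : nat) (b : 'I_k -> V), forall x, exists c, x = lincomb b c.

Record is_glattice L : Prop := IsGLattice {
  glat_fin_gen : fin_gen L;
  glformDl : forall x y z : L, glform (x + y) z = glform x z + glform y z;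
  glformDr : forall x y z : L, glform x (y + z) = glform x y + glform x z;
  glform_sym : forall x y : L, glform x y = glform y x;
  glform_gt0 : forall x : L, x != 0 -> 0 < glform x x;
  glactD : forall (s : gT) (x y : L), glact s (x + y) = glact s x + glact s y;
  glact1 : forall x : L, glact 1%g x = x;
  glactM : forall (s t : gT) (x : L), glact (s * t)%g x = glact s (glact t x);
  glact_isom : forall (s : gT) (x y : L),
    glform (glact s x) (glact s y) = glform x y;
  glact_u : forall x : L, glact u x = - x
}.

Definition zbasis (V : zmodType) (k : nat) (b : 'I_k -> V) : Prop :=
  forall x : V, exists! c, x = lincomb b c.

Definition gram L (k : nat) (b : 'I_k -> L) : 'M[int]_k :=
  \matrix_(i, j) glform (b i) (b j).

(* The last clause: the cosets of the [glact s e] generate the abelian group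
   L/mL. *)
Definition invertible L : Prop :=
  [/\ is_glattice L,
      exists b : 'I_(#|gT|./2) -> L, zbasis b /\ \det (gram b) = 1
    & forall m : nat, (0 < m)%N ->
        exists e : L, forall x : L,
        exists c (y : L), x = lincomb (fun s : gT => glact s e) c + y *+ m].

Definition giso L M : Prop :=
  exists f : {additive L -> M},
    [/\ bijective f,
        forall x y : L, glform (f x) (f y) = glform x y
      & forall (s : gT) (x : L), f (glact s x) = glact s (f x)].

(* The copy \bar L has the same carrier and form as L. *)
Definition gbar L : gdata gT :=
  GData (@glform _ L) (fun s (x : L) => glact s^-1%g x).

Lemma giso_refl L : giso L L.
Proof. by exists idfun; split=> //; exists id. Qed.

Lemma giso_sym L M : giso L M -> giso M L.
Proof.
case=> f [[g fK gK] fE fA].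
have gD : zmod_morphism g.
  by move=> x y; apply: (can_inj fK); rewrite raddfB /= !gK.
pose ga := GRing.isZmodMorphism.Build _ _ g gD.
pose h : {additive M -> L} := HB.pack g ga.
exists h; split=> /=.
- by exists f.
- by move=> x y; rewrite -fE !gK.
- by move=> s x; apply: (can_inj fK); rewrite fA !gK.
Qed.

Lemma giso_trans L M N : giso L M -> giso M N -> giso L N.
Proof.
case=> f [bf fE fA] [g [bg gE gA]]; exists (g \o f); split=> /=.
- exact: bij_comp.
- by move=> x y; rewrite gE fE.
- by move=> s x; rewrite fA gA.
Qed.

Record invglat := InvGLat { iglat :> gdata gT; iglatP : invertible iglat }.

Definition iso_class (L : invglat) : invglat -> Prop :=
  fun M : invglat => giso L M.

(* The set of isomorphism classes.  [{eq_quot _}] is not available: [invglat]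
   quantifies over [zmodType] and is too large to be a [choiceType]. *)
Definition WPic : Type :=
  {C : invglat -> Prop | exists L : invglat, C = iso_class L}.

Definition wclass L (iL : invertible L) : WPic :=
  exist _ (iso_class (InvGLat iL)) (ex_intro _ (InvGLat iL) erefl).

Lemma wclass_eqP L M (iL : invertible L) (iM : invertible M) :
  wclass iL = wclass iM <-> giso L M.
Proof.
split=> [[/(congr1 (fun C => C (InvGLat iM)))]|LM].
  by rewrite /iso_class /= => ->; apply: giso_refl.
apply: eq_exist; apply/funext=> N; apply/propext; rewrite /iso_class /=.
split; last exact: giso_trans.
by apply: giso_trans; apply: giso_sym.
Qed.

End GLattice.

Section Operations.
Variables (gT : finGroupType) (cG : abelian [set: gT]).
Variables (u : gT) (ou : #[u]%g = 2%N).
Local Notation zg := (zg cG ou).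
Local Notation zg_of := (zg_of cG ou).
Implicit Types L M : gdata gT.

Definition zg_lattice : gdata gT :=
  @GData gT zg (fun x y => zg_t (x * zg_bar y)) (fun s x => zg_of s * x).

Definition zg_act L (r : zg) (x : L) : L :=
  lincomb (fun s => glact s x) (generic_quotient.repr r : group_ring cG).

(* [lift_form x y] is x . \bar y. *)
Definition lift_form L (x y : L) : zg :=
  \sum_(s in transversal (rcosets <[u]> [set: gT]) [set: gT])
    zg_of s *~ glform x (glact s y).

Definition free_ext (K : choiceType) (V : zmodType) (f : K -> V)
  (D : {freeg K}) : V := \sum_(k <- dom D) f k *~ coeff k D.

Section Tensor.
Variables L M : gdata gT.
Local Notation FLM := {freeg (L * M)}.
Local Notation "x ## v" := (<< (x, v) >> : FLM) (at level 30).

Variant tensor_rel : FLM -> Prop :=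
| TensorDl (x y : L) (v : M) : tensor_rel ((x + y) ## v - x ## v - y ## v)
| TensorDr (x : L) (v w : M) : tensor_rel (x ## (v + w) - x ## v - x ## w)
| TensorZ (r : zg) (x : L) (v : M) :
    tensor_rel (zg_act r x ## v - x ## zg_act r v).

Definition tensor : Type := {ideal_quot (gensub tensor_rel)}.
HB.instance Definition _ := GRing.Zmodule.on tensor.
HB.instance Definition _ := Quotient.on tensor.

Definition tens (x : L) (v : M) : tensor := \pi_tensor (x ## v).

(* [tensor_lift a b] is a . \bar b, the biadditive extension of
   (x (x) v) . (\bar y (x) \bar w) = (x . \bar y) (v . \bar w). *)
Definition tensor_lift (a b : tensor) : zg :=
  free_ext (fun p => free_ext
    (fun q => lift_form p.1 q.1 * lift_form p.2 q.2)
    (generic_quotient.repr b)) (generic_quotient.repr a).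

Definition gtensor : gdata gT :=
  @GData gT tensor (fun a b => zg_t (tensor_lift a b))
    (fun s a => free_ext (fun p => tens (glact s p.1) p.2)
                  (generic_quotient.repr a)).

End Tensor.
End Operations.

Section FreeExt.
Variables (K : choiceType) (V : zmodType) (f : K -> V).

Lemma free_extE (D : {freeg K}) : free_ext f D = fglift (f : K -> zmodule V) D.
Proof.
rewrite -{2}[D]Freeg_dom fglift_Freeg /prelift big_map.
by apply: eq_bigr => k _.
Qed.

Lemma free_ext_is_additive : zmod_morphism (free_ext f).
Proof. by move=> D E; rewrite !free_extE lift_is_additive. Qed.
HB.instance Definition _ :=
  GRing.isZmodMorphism.Build {freeg K} V (free_ext f) free_ext_is_additive.

Lemma free_extU k : free_ext f << k >> = f k.
Proof. by rewrite free_extE liftU scale1r. Qed.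
End FreeExt.

Lemma gensub0 (V W : zmodType) (A : V -> Prop) (h : {additive V -> W}) :
  (forall a, A a -> h a = 0) -> forall v, v \in gensub A -> h v = 0.
Proof.
move=> hA v /asboolP /(_ [pred v | h v == 0]) hv; apply/eqP/hv.
  by split=> [|x y /eqP hx /eqP hy]; rewrite inE ?raddf0 ?raddfB ?hx ?hy ?subrr.
by move=> a /hA ha; rewrite inE ha.
Qed.

Section WellDefined.
Variables (gT : finGroupType) (cG : abelian [set: gT]).
Variables (u : gT) (ou : #[u]%g = 2%N).
Local Notation ZG := (group_ring cG).
Local Notation zg := (zg cG ou).
Local Notation zg_of := (zg_of cG ou).

Lemma gr_addE (a b : ZG) s : (a + b) s = a s + b s.
Proof. by rewrite ffunE. Qed.
Lemma gr_subE (a b : ZG) s : (a - b) s = a s - b s.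
Proof. by rewrite !ffunE. Qed.
Lemma gr_barE (a : ZG) s : gr_bar a s = a s^-1%g.
Proof. by rewrite ffunE. Qed.

Lemma u1_idealP (a : ZG) :
  reflect (exists b : ZG, a = b * (gr_of cG u + 1)) (a \in u1_ideal ou).
Proof. exact: asboolP. Qed.

Lemma repr_pi_zg (a : ZG) : exists b : ZG,
  generic_quotient.repr (\pi_zg a) = a + b * (gr_of cG u + 1).
Proof.
have : generic_quotient.repr (\pi_zg a) - a \in u1_ideal ou.
  by rewrite Quotient.idealrBE reprK.
by case/u1_idealP => b ab; exists b; rewrite -ab addrC subrK.
Qed.

Lemma zg_t_pi (a : ZG) : zg_t (\pi_zg a) = gr_t u a.
Proof.
rewrite /zg_t; have [b ->] := repr_pi_zg a.
have := gr_t_u1 ou b; rewrite /gr_t !gr_addE => /eqP; rewrite subr_eq0 => /eqP ->.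
by rewrite opprD addrACA subrr addr0.
Qed.

Lemma invgu : u^-1%g = u.
Proof. by apply/eqP; rewrite eq_invg_mul (mulguu ou). Qed.

Lemma zg_bar_pi (a : ZG) : zg_bar (\pi_zg a) = \pi_zg (gr_bar a).
Proof.
rewrite /zg_bar; have [b ->] := repr_pi_zg a.
apply/eqP; rewrite -Quotient.idealrBE; apply/u1_idealP; exists (gr_bar b).
apply/ffunP=> s; rewrite (gr_mulu1E ou).
rewrite gr_subE !gr_barE gr_addE (gr_mulu1E ou).
rewrite invMg invgu [(u * _)%g](abelian_mulgC cG).
by rewrite [(_ + _ - _)]addrAC subrr add0r.
Qed.

Lemma zg_ofM s t : zg_of (s * t)%g = zg_of s * zg_of t.
Proof.
rewrite /zg_of -[RHS]rmorphM /=; congr (\pi_zg _).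
apply/ffunP=> x; rewrite [_ * _]/(gr_mul _ _) gr_mulE !ffunE.
congr (nat_of_bool _)%:R.
by rewrite -[RHS](inj_eq (mulgI s)) mulKVg.
Qed.

Lemma zg_of_u : zg_of u = -1.
Proof.
apply/eqP; rewrite -addr_eq0 -(rmorph1 \pi_zg) -rmorphD /=.
rewrite -(raddf0 \pi_zg) -Quotient.idealrBE subr0.
by apply/u1_idealP; exists 1; rewrite mul1r.
Qed.

Lemma gr_sum (a : ZG) : a = \sum_s gr_of cG s *~ a s.
Proof.
apply/ffunP=> x; rewrite sum_ffunE (bigD1 x) //= big1 ?addr0 => [|y].
  by rewrite ffunMzE ffunE eqxx intz.
by rewrite eq_sym => /negbTE yx; rewrite ffunMzE ffunE yx mul0rz.
Qed.

Lemma zg_sum (a : ZG) : \pi_zg a = \sum_s zg_of s *~ a s.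
Proof.
rewrite {1}[a]gr_sum raddf_sum; apply: eq_bigr => s _.
by rewrite raddfMz.
Qed.

Local Notation cosu := (rcosets <[u]>%g [set: gT]).

Lemma sum_transversal (V : zmodType) (F : gT -> V) (X Y : {set gT}) :
  (forall s, F (u * s)%g = F s) ->
  is_transversal X cosu [set: gT] -> is_transversal Y cosu [set: gT] ->
  \sum_(s in X) F s = \sum_(s in Y) F s.
Proof.
move=> Fu.
suff H Z : is_transversal Z cosu [set: gT] ->
    \sum_(s in Z) F s = \sum_(B in cosu) F (fingroup.repr B).
  by move=> trX trY; rewrite !H.
move=> trZ; rewrite -(pblock_transversal trZ).
rewrite big_imset /=; last exact: pblock_inj trZ.
apply: eq_bigr => s Zs; have /and3P[/and3P[/eqP cov ti _] _ _] := trZ.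
have -> : pblock cosu s = (<[u]> :* s)%g.
  apply: def_pblock => //; last exact: rcoset_refl.
  by apply/rcosetsP; exists s.
have /rcosetP[x /cycleP[i ->] ->] : fingroup.repr (<[u]> :* s)%g \in (<[u]> :* s)%g.
  by apply: mem_repr; apply: rcoset_refl.
by elim: i => [|i IH]; rewrite ?expg0 ?mul1g // expgS -mulgA Fu.
Qed.

Lemma transversal_shift s (X : {set gT}) :
  is_transversal X cosu [set: gT] ->
  is_transversal [set (s * x)%g | x in X] cosu [set: gT].
Proof.
case/and3P=> pX _ /forallP trX; apply/and3P; split=> //.
apply/forallP=> B; apply/implyP=> /rcosetsP[x _ ->].
have /implyP/(_ _)/eqP <- := trX (<[u]> :* (s^-1 * x))%g; last first.
  by apply/rcosetsP; exists (s^-1 * x)%g.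
rewrite -(card_imset _ (mulgI s)); apply/eqP; congr #|pred_of_set _|.
apply/setP=> y; apply/setIP/imsetP=> [[/imsetP[z Xz ->]]|[z /setIP[Xz]]].
  move=> zB; exists z => //; rewrite inE Xz /=; move: zB.
  by rewrite !mem_rcoset invMg invgK [(_ * s)%g](abelian_mulgC cG) mulgA
             [(s * z)%g](abelian_mulgC cG).
move=> zB ->; split; first exact: imset_f.
move: zB; rewrite !mem_rcoset invMg invgK [(_ * s)%g](abelian_mulgC cG) mulgA.
by rewrite [(s * z)%g](abelian_mulgC cG).
Qed.

Lemma zg_act_pi (L : gdata gT) (a : ZG) (x : L) : is_glattice u L ->
  zg_act (\pi_zg a) x = \sum_s glact s x *~ a s.
Proof.
move=> hL; rewrite /zg_act /lincomb; have [b ->] := repr_pi_zg a.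
under eq_bigr => s _ do rewrite gr_addE mulrzDr.
rewrite big_split /= [X in _ + X](_ : _ = 0) ?addr0 //.
under eq_bigr => s _ do rewrite (gr_mulu1E ou) mulrzDr.
rewrite big_split /= (reindex_inj (mulgI u)) /=.
rewrite -big_split big1 //= => s _.
by rewrite mulgA (mulguu ou) mul1g (glactM hL) (glact_u hL) mulNrz addNr.
Qed.

Section Lattice.
Variables (L : gdata gT) (hL : is_glattice u L).
Local Notation lift_form := (@lift_form _ cG u ou L).

Lemma glact_is_additive s : zmod_morphism (@glact _ L s).
Proof.
by move=> x y; rewrite -[LHS](addrK (glact s y)) -(glactD hL) subrK.
Qed.

Lemma glforml_is_additive y : zmod_morphism ((@glform _ L)^~ y).
Proof. by move=> x z; rewrite -[LHS](addrK (glform z y)) -(glformDl hL) subrK. Qed.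
Lemma glformr_is_additive x : zmod_morphism (@glform _ L x).
Proof. by move=> y z; rewrite -[LHS](addrK (glform x z)) -(glformDr hL) subrK. Qed.
Lemma glformNr x y : glform x (- y : L) = - glform x y.
Proof.
have := glformr_is_additive x 0 y; have := glformr_is_additive x 0 0.
by rewrite !sub0r oppr0 subrr => ->; rewrite sub0r.
Qed.

Lemma lift_forml_is_additive y : zmod_morphism (lift_form^~ y).
Proof.
move=> x z; rewrite -sumrB; apply: eq_bigr => s _.
by rewrite -mulrzBr (glforml_is_additive _ x z).
Qed.
Lemma lift_formr_is_additive x : zmod_morphism (lift_form x).
Proof.
move=> y z; rewrite -sumrB; apply: eq_bigr => s _.
by rewrite -mulrzBr glact_is_additive glformr_is_additive.
Qed.

Lemma lift_form_transversal (X : {set gT}) x y :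
  is_transversal X cosu [set: gT] ->
  lift_form x y = \sum_(s in X) zg_of s *~ glform x (glact s y).
Proof.
move=> trX; apply: sum_transversal => //; last first.
  by apply/transversalP/rcosets_partition/subsetT.
move=> s; rewrite zg_ofM zg_of_u mulN1r (glactM hL) (glact_u hL).
by rewrite glformNr mulrNz mulNrz opprK.
Qed.

Lemma lift_form_actl s x y : lift_form (glact s x) y = zg_of s * lift_form x y.
Proof.
have trT : is_transversal (transversal cosu [set: gT]) cosu [set: gT].
  by apply/transversalP/rcosets_partition/subsetT.
rewrite (lift_form_transversal _ _ (transversal_shift s trT)).
rewrite big_imset /= => [|t t' _ _ /mulgI //].
rewrite mulr_sumr; apply: eq_bigr => t _.
by rewrite zg_ofM mulrzAr (glactM hL) (glact_isom hL).
Qed.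

Lemma lift_form_actr s x y :
  lift_form x (glact s y) = zg_of s^-1%g * lift_form x y.
Proof.
have trT : is_transversal (transversal cosu [set: gT]) cosu [set: gT].
  by apply/transversalP/rcosets_partition/subsetT.
rewrite (lift_form_transversal _ _ (transversal_shift s^-1%g trT)).
rewrite big_imset /= => [|t t' _ _ /mulgI //].
rewrite mulr_sumr; apply: eq_bigr => t _.
rewrite zg_ofM mulrzAr -(glactM hL) -mulgA [(t * s)%g](abelian_mulgC cG).
by rewrite mulKg.
Qed.

Lemma lift_form_zgl (r : zg) x y :
  lift_form (zg_act r x) y = r * lift_form x y.
Proof.
pose h := GRing.isZmodMorphism.Build _ _ _ (lift_forml_is_additive y).
pose f : {additive L -> zg} := HB.pack (lift_form^~ y) h.
elim/quotW: r => a; rewrite (zg_act_pi _ _ hL) zg_sum mulr_suml.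
rewrite -[LHS]/(f _) raddf_sum; apply: eq_bigr => s _.
by rewrite raddfMz /= lift_form_actl mulrzAl.
Qed.

Lemma lift_form_zgr (r : zg) x y :
  lift_form x (zg_act r y) = zg_bar r * lift_form x y.
Proof.
pose h := GRing.isZmodMorphism.Build _ _ _ (lift_formr_is_additive x).
pose f : {additive L -> zg} := HB.pack (lift_form x) h.
elim/quotW: r => a; rewrite (zg_act_pi _ _ hL) zg_bar_pi zg_sum mulr_suml.
rewrite -[LHS]/(f _) raddf_sum (reindex_inj invg_inj); apply: eq_bigr => s _.
by rewrite raddfMz /= lift_form_actr mulrzAl gr_barE invgK.
Qed.

End Lattice.

Section TensorForm.
Variables (L M : gdata gT) (hL : is_glattice u L) (hM : is_glattice u M).
Local Notation FLM := {freeg (L * M)}.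
Local Notation tensor := (tensor cG ou L M).

Lemma tensor_pi_eq (V : zmodType) (f : {additive FLM -> V}) (D : FLM) :
  (forall a, tensor_rel cG ou a -> f a = 0) ->
  f (generic_quotient.repr (\pi_tensor D)) = f D.
Proof.
move=> f0; apply/eqP; rewrite -subr_eq0 -raddfB.
by apply/eqP/(gensub0 f0); rewrite Quotient.idealrBE reprK.
Qed.

Let F (p q : L * M) : zg :=
  lift_form cG ou p.1 q.1 * lift_form cG ou p.2 q.2.

Let FD (N : gdata gT) (hN : is_glattice u N) (x y z : N) :
  lift_form cG ou (x + y) z = lift_form cG ou x z + lift_form cG ou y z.
Proof.
by rewrite -{2}[x](addrK y) (lift_forml_is_additive hN) subrK.
Qed.
Let FDr (N : gdata gT) (hN : is_glattice u N) (x y z : N) :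
  lift_form cG ou x (y + z) = lift_form cG ou x y + lift_form cG ou x z.
Proof.
by rewrite -{2}[y](addrK z) (lift_formr_is_additive hN) subrK.
Qed.

Lemma tensor_lift_pi (D E : FLM) :
  tensor_lift (\pi_tensor D) (\pi_tensor E) =
  free_ext (fun p => free_ext (F p) E) D.
Proof.
rewrite /tensor_lift -/F.
transitivity (free_ext (fun p => free_ext (F p)
    (generic_quotient.repr (\pi_tensor E))) D).
  apply: tensor_pi_eq => _ [x y v|x v w|r x v];
    rewrite !raddfB /= !free_extU; set E' := generic_quotient.repr _;
    rewrite /free_ext -?sumrB ?big1 // => -[y' w'] _ /=.
  - by rewrite /F /= (FD hL) mulrDl mulrzDl addrAC addrK subrr.
  - by rewrite /F /= (FD hM) mulrDr mulrzDl addrAC addrK subrr.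
  - by rewrite /F /= (lift_form_zgl hL) (lift_form_zgl hM) mulrCA mulrA subrr.
apply: eq_bigr => -[y w] _; congr (_ *~ _).
apply: tensor_pi_eq => _ [x x' v|x v v'|r x v]; rewrite !raddfB /= !free_extU.
- by rewrite /F /= (FDr hL) mulrDl addrAC addrK subrr.
- by rewrite /F /= (FDr hM) mulrDr addrAC addrK subrr.
- by rewrite /F /= (lift_form_zgr hL) (lift_form_zgr hM) mulrCA mulrA subrr.
Qed.

Lemma tensor_lift_tens (x y : L) (v w : M) :
  tensor_lift (tens cG ou x v) (tens cG ou y w) =
  lift_form cG ou x y * lift_form cG ou v w.
Proof. by rewrite tensor_lift_pi !free_extU. Qed.

Lemma tensor_rel0 (D : FLM) : tensor_rel cG ou D -> \pi_tensor D = 0.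
Proof.
move=> relD; apply/eqP; rewrite -(raddf0 \pi_tensor) -Quotient.idealrBE subr0.
by apply/asboolP => S _; apply.
Qed.

Lemma zg_act_glact (r : zg) s (x : L) :
  zg_act r (glact s x) = glact s (zg_act r x).
Proof.
pose h := GRing.isZmodMorphism.Build _ _ _ (glact_is_additive hL s).
pose f : {additive L -> L} := HB.pack (@glact _ L s) h.
transitivity (f (zg_act r x)); last by [].
rewrite raddf_sum; apply: eq_bigr => t _; rewrite raddfMz /=.
by rewrite -!(glactM hL) (abelian_mulgC cG).
Qed.

Lemma glact_tens s (x : L) (v : M) :
  glact s (tens cG ou x v : gtensor cG ou L M) = tens cG ou (glact s x) v.
Proof.
pose g (p : L * M) : tensor := tens cG ou (glact s p.1) p.2.
transitivity (free_ext g (generic_quotient.repr (tens cG ou x v))); first by [].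
rewrite -[RHS](free_extU g (x, v)); apply: (tensor_pi_eq (f := free_ext g)).
move=> _ [{}x y {}v|{}x {}v w|r {}x {}v];
  rewrite !raddfB /= !free_extU /g /tens /= -!raddfB; apply: tensor_rel0.
- by rewrite (glactD hL); apply: TensorDl.
- exact: TensorDr.
- by rewrite -zg_act_glact; apply: TensorZ.
Qed.

End TensorForm.
End WellDefined.

(* Main.v *)
Require Import Defs.
From HB Require Import structures.
From mathcomp Require Import all_boot all_order all_fingroup all_algebra.
From mathcomp Require Import boolp freeg ring lra zify.

(* Write A for Z<G> and x.y for the lifted inner product. If e generates L/mL
   over A then unimodularity gives y with e.y = 1 mod m. Hence the trace ideal I
   spanned by all x.y satisfies I + mA = A for every m; m = 2 puts an odd integer
   N in I, and m = N gives I = A. Since L is A e up to odd index,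
   (x.y) z = (z.y) x for all x, y, z. These two facts say that L is an
   invertible A-module with inverse \bar L, and they show that the form on a
   tensor product is nondegenerate. It is positive semidefinite because, after
   averaging over the maps s (x) s^-1, it is a Schur product of Gram matrices.
   Rank and determinant of L (x) M are read off modulo m from the generator
   e (x) f and its dual y (x) w. Isomorphisms only have to be checked to be
   isometric and onto: definiteness makes them injective. *)

Set Implicit Arguments.
Unset Strict Implicit.
Unset Printing Implicit Defensive.

Import Order.TTheory GRing.Theory Num.Theory.
Local Open Scope ring_scope.
Local Open Scope quotient_scope.

(** In general Z<G> is not a domain and L is not free over it, so one generator is only available
    modulo m. Each local statement becomes global through a determinant congruent to 1 modulo m, and
    the later moduli come out of the earlier steps: m = 2 makes N nonzero, so that |N| may serve as
    the next modulus; positivity makes the Gram determinant d of L (x) M nonzero, so that d may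
    serve too, and then d divides 1. The average over s (x) s^-1 changes nothing because sx (x) s^-1
    v = x (x) v. Everything stays over Z, so Schur complements scaled by their pivots replace
    spectral decompositions. Semidefinite becomes definite as follows. A null vector a satisfies a .
    \bar b = 0 for all b; partitions of unity sum x.y = 1 and sum v.w = 1 give the expansion a = sum
    (a . \bar{y (x) w}) (x (x) v), hence a = 0. The same two facts make \bar x (x) y -> y . \bar x
    an isometry of \bar L (x) L onto Z<G>. *)

Section IntegerCongruence.
Variable m : int.

Definition congz (x y : int) : Prop := exists q, x = y + m * q.

Lemma congz_refl x : congz x x.
Proof. by exists 0; rewrite mulr0 addr0. Qed.

Lemma congzD x y x' y' : congz x y -> congz x' y' -> congz (x + x') (y + y').
Proof. by case=> q -> [q' ->]; exists (q + q'); ring. Qed.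

Lemma congzM x y x' y' : congz x y -> congz x' y' -> congz (x * x') (y * y').
Proof. by case=> q -> [q' ->]; exists (q * y' + y * q' + m * q * q'); ring. Qed.

Lemma congz_det k (A B : 'M[int]_k) :
  (forall i j, congz (A i j) (B i j)) -> congz (\det A) (\det B).
Proof.
move=> AB; rewrite /determinant.
apply: (big_ind2 congz) => [|x y x' y'|s _]; first exact: congz_refl.
  exact: congzD.
apply: congzM; first exact: congz_refl.
apply: (big_ind2 congz) => [|x y x' y'|i _]; first exact: congz_refl.
  exact: congzM.
exact: AB.
Qed.

Lemma congz_det1 k (A : 'M[int]_k) : congz (\det (1%:M + m *: A)) 1.
Proof.
rewrite -[X in congz _ X](det1 int k); apply: congz_det => i j.
by exists (A i j); rewrite !mxE.
Qed.

End IntegerCongruence.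

(** * Integer matrices acting on finite families; Nakayama and bases *)

Section FamilyAction.
Variable V : zmodType.

Definition mxfam k l (A : 'M[int]_(k, l)) (b : 'I_l -> V) : 'I_k -> V :=
  fun i => \sum_j b j *~ A i j.

Lemma mxfam_lincomb l (b : 'I_l -> V) c :
  lincomb b c = mxfam (\row_j c j) b 0.
Proof. by apply: eq_bigr => j _; rewrite mxE. Qed.

Lemma lincomb_mxfam k l (A : 'M[int]_(k, l)) b i :
  mxfam A b i = lincomb b [ffun j => A i j].
Proof. by apply: eq_bigr => j _; rewrite ffunE. Qed.

Lemma mxfam_mul k l p (A : 'M[int]_(k, l)) (B : 'M[int]_(l, p)) b i :
  mxfam (A *m B) b i = mxfam A (mxfam B b) i.
Proof.
rewrite /mxfam.
under [RHS]eq_bigr => j _ do rewrite mulrz_suml.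
rewrite exchange_big; apply: eq_bigr => j _.
rewrite mxE mulrz_sumr; apply: eq_bigr => q _.
by rewrite -mulrzA mulrC.
Qed.

Lemma mxfam_scalar k (a : int) (b : 'I_k -> V) i : mxfam a%:M b i = b i *~ a.
Proof.
rewrite /mxfam (bigD1 i) //= big1 ?addr0 => [|j /negbTE ji].
  by rewrite mxE eqxx mulr1n.
by rewrite mxE eq_sym ji mulr0n mulr0z.
Qed.

Lemma mxfam1 k (b : 'I_k -> V) i : mxfam 1%:M b i = b i.
Proof. by rewrite mxfam_scalar mulr1z. Qed.

Lemma mxfamD k l (A B : 'M[int]_(k, l)) b i :
  mxfam (A + B) b i = mxfam A b i + mxfam B b i.
Proof. by rewrite -big_split; apply: eq_bigr => j _; rewrite mxE mulrzDr. Qed.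

Lemma mxfamN k l (A : 'M[int]_(k, l)) b i : mxfam (- A) b i = - mxfam A b i.
Proof. by rewrite -sumrN; apply: eq_bigr => j _; rewrite mxE mulrNz. Qed.

Lemma mxfamZ k l (m : int) (A : 'M[int]_(k, l)) b i :
  mxfam (m *: A) b i = mxfam A b i *~ m.
Proof.
rewrite /mxfam mulrz_suml; apply: eq_bigr => j _.
by rewrite mxE mulrzA_C.
Qed.

Lemma eq_mxfam k l (A : 'M[int]_(k, l)) b b' :
  b =1 b' -> mxfam A b =1 mxfam A b'.
Proof. by move=> bb' i; apply: eq_bigr => j _; rewrite bb'. Qed.

Lemma mxfam_choose l (b : 'I_l -> V) k (f : 'I_k -> V) :
  (forall x, exists c, x = lincomb b c) -> exists A : 'M[int]_(k, l), f =1 mxfam A b.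
Proof.
move=> gb; have /choice[c cE] : forall i, exists c, f i = lincomb b c by [].
exists (\matrix_(i, j) c i j) => i; rewrite cE lincomb_mxfam; congr lincomb.
by apply/ffunP=> j; rewrite ffunE mxE.
Qed.

Lemma zbasis_gen k (b : 'I_k -> V) :
  zbasis b -> forall x, exists c, x = lincomb b c.
Proof. by move=> zb x; have [c [? _]] := zb x; exists c. Qed.

Lemma zbasis_mx_inj k (b : 'I_k -> V) l (A B : 'M[int]_(l, k)) :
  zbasis b -> mxfam A b =1 mxfam B b -> A = B.
Proof.
move=> zb AB; apply/matrixP => i j.
have [c [_ cU]] := zb (mxfam A b i).
have cA := cU _ (lincomb_mxfam A b i).
have := cU [ffun j => B i j]; rewrite AB => /(_ (lincomb_mxfam B b i)) cB.
by have /ffunP/(_ j) := etrans (esym cA) cB; rewrite !ffunE.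
Qed.

Lemma zbasisP k (b : 'I_k -> V) :
  (forall x, exists c, x = lincomb b c) ->
  (forall c, lincomb b c = 0 -> c = 0) -> zbasis b.
Proof.
move=> gb b0 x; have [c xE] := gb x; exists c; split=> // c' xE'.
apply/eqP; rewrite -subr_eq0; apply/eqP/b0; rewrite /lincomb.
under eq_bigr => i _ do rewrite !ffunE mulrzBr.
by rewrite sumrB -!/(lincomb _ _) -xE -xE' subrr.
Qed.

(* Nakayama's lemma for Z: multiply [(1 - m X) b = w] by the adjugate. *)
Lemma subgroup_mod_cofinite (m : nat) (W : V -> Prop) :
  fin_gen V -> W 0 -> (forall x y, W x -> W y -> W (x - y)) ->
  (forall x, exists w y, W w /\ x = w + y *+ m) ->
  exists2 N : int, congz m%:Z N 1 & forall x, W (x *~ N).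
Proof.
move=> [k [b gb]] W0 WB WT.
have WN x : W x -> W (- x) by move=> Wx; rewrite -sub0r; apply: WB.
have WD x y : W x -> W y -> W (x + y).
  by move=> Wx Wy; rewrite -[y]opprK; apply: (WB _ _ Wx (WN _ Wy)).
have WZ x (z : int) : W x -> W (x *~ z).
  move=> Wx; have Wn q : W (x *+ q).
    by elim: q => [|q IH]; rewrite ?mulr0n // mulrS; apply: WD.
  by case: z => q; [apply: Wn | apply/WN/Wn].
have Wsum (I : finType) (F : I -> V) : (forall i, W (F i)) -> W (\sum_i F i).
  by move=> WF; apply: (big_ind W).
have /choice[wy wyE] : forall i, exists p : V * V,
    W p.1 /\ b i = p.1 + p.2 *+ m.
  by move=> i; have [w [y ?]] := WT (b i); exists (w, y).
have [X XE] := mxfam_choose (fun i => (wy i).2) gb.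
pose Y : 'M[int]_k := 1%:M + m%:Z *: (- X).
have YE i : mxfam Y b i = (wy i).1.
  rewrite mxfamD mxfam1 mxfamZ mxfamN mulNrz -XE.
  by have [_ {1}->] := wyE i; rewrite -pmulrn addrK.
exists (\det Y); first exact: congz_det1.
have Wb i : W (b i *~ \det Y).
  rewrite -mxfam_scalar -mul_adj_mx mxfam_mul (eq_mxfam _ YE).
  by apply: Wsum => j; apply: WZ; have [] := wyE j.
move=> x; have [c ->] := gb x; rewrite /lincomb mulrz_suml.
by apply: Wsum => j; rewrite mulrzAC; apply: WZ.
Qed.

(* A relation among a generating family of minimal size can be put in the form
   [d * b'_0 = 0] by Smith normal form, which makes [b'_0] superfluous. *)
Lemma fin_gen_zbasis :
  fin_gen V -> (forall (x : V) (d : int), x *~ d = 0 -> d != 0 -> x = 0) ->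
  exists k (b : 'I_k -> V), zbasis b.
Proof.
move=> fg tf.
pose P k := `[< exists b : 'I_k -> V, forall x, exists c, x = lincomb b c >].
have exP : exists k, P k by have [k bP] := fg; exists k; apply/asboolP.
case: (ex_minnP exP) => k /asboolP[b gb] kmin.
exists k, b; apply: zbasisP => // c c0; apply/ffunP=> j0; rewrite ffunE.
apply/eqP/negPn/negP => cj0.
case: k b gb kmin c c0 j0 cj0 => [|k] b gb kmin c c0 j0 cj0; first by case: (j0).
(* The relation is a single row, so its Smith form has at most one nonzero entry, in column 0, and
   [U] is a 1 by 1 matrix. *)
have [U Uu [R Ru [d _ CE]]] := int_Smith_normal_form (\row_j c j).
pose b' := mxfam R b.
have bE : b =1 mxfam (invmx R) b'.
  by move=> i; rewrite -mxfam_mul mulVmx // mxfam1.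
have CE0 : U *m \matrix_(i < 1, j < k.+1) (d`_i *+ (i == j :> nat)) =
           \row_j (U 0 0 * d`_0 *+ (j == 0)).
  apply/matrixP=> i j; rewrite !mxE big_ord1 !mxE ord1 /=.
  rewrite [(j == 0)](_ : _ = (0%N == j :> nat)) 1?eq_sym //.
  by case: eqP => _; rewrite ?mulr1n // !mulr0n mulr0.
have d0 : U 0 0 * d`_0 != 0.
  apply/eqP=> e0; have /matrixP/(_ 0 j0) := CE; rewrite CE0 e0.
  rewrite [in X in _ = X]mxE mxE big1 => [/eqP|i _]; first by rewrite (negbTE cj0).
  by rewrite mxE mul0rn mul0r.
have b'0 : b' 0 = 0.
  apply: (tf _ _ _ d0); rewrite -[RHS]c0 mxfam_lincomb CE CE0 mxfam_mul -/b'.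
  rewrite [RHS](bigD1 0) //= big1 ?addr0 => [|i i0]; rewrite mxE ?(negbTE i0) //.
have : P k; last by move/kmin; rewrite ltnn.
apply/asboolP; exists (fun i => b' (fintype.lift 0 i)) => x; have [c' ->] := gb x.
rewrite mxfam_lincomb (eq_mxfam _ bE) -mxfam_mul lincomb_mxfam.
set c2 := [ffun _ => _]; exists [ffun i => c2 (fintype.lift 0 i)].
rewrite /lincomb big_ord_recl b'0 mul0rz add0r.
by apply: eq_bigr => i _; rewrite [in RHS]ffunE.
Qed.

End FamilyAction.

Lemma raddf_mxfam (V W : zmodType) (f : {additive V -> W}) k l
  (A : 'M[int]_(k, l)) b i : f (mxfam A b i) = mxfam A (f \o b) i.
Proof. by rewrite raddf_sum; apply: eq_bigr => j _; rewrite raddfMz. Qed.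

(** * Positive integer matrices: determinants and Schur products *)

Section PositiveMatrices.

Definition posdefmx k (A : 'M[int]_k) : Prop :=
  forall x : 'rV_k, x != 0 -> 0 < (x *m A *m x^T) 0 0.

(** An elimination step without division: scaling the lower rows by the pivot [a] keeps [U]
    integral, at the cost of factors [a] in the Schur complement. *)
Lemma block_congr k (a : int) (c : 'cV[int]_k) (D : 'M[int]_k) :
  let U : 'M[int]_(1 + k) := block_mx 1%:M 0 (- c) a%:M in
  U *m block_mx a%:M c^T c D *m U^T = block_mx a%:M 0 0 (a *: (a *: D - c *m c^T)).
Proof.
move=> U; rewrite /U tr_block_mx trmx1 trmx0 tr_scalar_mx linearN /=.
have -> : block_mx 1%:M 0 (- c) a%:M *m block_mx a%:M c^T c D =
          block_mx a%:M c^T 0 (a *: D - c *m c^T).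
  rewrite mulmx_block !mul1mx !mul0mx !addr0 !mul_scalar_mx mul_mx_scalar.
  by rewrite scalerN addNr mulNmx addrC.
rewrite mulmx_block !mulmx1 !mulmx0 !mul0mx !addr0 !mul_mx_scalar add0r.
by rewrite mul_scalar_mx scalerN addNr.
Qed.

(* [U] clears the first row and column of [A]; congruence by [U] multiplies the
   determinant by a nonzero square. *)
Lemma posdefmx_det_gt0 k (A : 'M[int]_k) : A^T = A -> posdefmx A -> 0 < \det A.
Proof.
elim: k A => [|k IH] A; first by rewrite det_mx00.
rewrite -[k.+1]/(1 + k)%N in A *; move=> sA pA.
have {sA}[sur sdr] : (dlsubmx A)^T = ursubmx A /\ (drsubmx A)^T = drsubmx A.
  by rewrite trmx_dlsub trmx_drsub sA.
pose a := A 0 0; pose c := dlsubmx A; pose D := drsubmx A.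
have a0 : 0 < a.
  have := pA (delta_mx 0 0); rewrite -rowE trmx_delta -colE !mxE; apply.
  by apply/eqP=> /matrixP/(_ 0 0); rewrite !mxE !eqxx.
have AE : A = block_mx a%:M c^T c D.
  rewrite sur -[LHS]submxK; congr block_mx; apply/matrixP=> i j.
  by rewrite !mxE !ord1 eqxx; congr (A _ _); apply/val_inj.
pose U : 'M[int]_(1 + k) := block_mx 1%:M 0 (- c) a%:M.
pose S := a *: (a *: D - c *m c^T).
have UE : U *m A *m U^T = block_mx a%:M 0 0 S by rewrite AE; apply: block_congr.
have dU : \det U != 0.
  by rewrite det_lblock det1 mul1r det_scalar expf_neq0 // gt_eqF.
have pS : posdefmx S.
  move=> x x0; pose y : 'rV[int]_(1 + k) := row_mx 0 x.
  have y0 : y *m U != 0.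
    apply/eqP => /(congr1 (mulmx^~ (\adj U))).
    rewrite -mulmxA mul_mx_adj mul_mx_scalar mul0mx => yE.
    case/eqP: x0; apply/matrixP=> i j; apply: (mulfI dU).
    have /matrixP/(_ i (rshift 1 j)) := yE.
    by rewrite mxE /y row_mxEr => ->; rewrite !mxE mulr0.
  have := pA _ y0; rewrite trmx_mul !mulmxA -[y *m U *m A]mulmxA -2!mulmxA.
  rewrite [U *m A *m _]mulmxA UE /y tr_row_mx mulmxA mul_row_block mul_row_col.
  by rewrite !mul0mx mulmx0 !add0r trmx0 mulmx0 add0r.
have sS : S^T = S.
  by rewrite /S !linearZ /= linearB /= linearZ /= trmx_mul trmxK sdr.
have : \det (U *m A *m U^T) = a * \det S by rewrite UE det_lblock det_scalar1.
rewrite !det_mulmx det_tr mulrAC => dE.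
have : 0 < \det U * \det U * \det A by rewrite dE mulr_gt0 // IH.
by rewrite pmulr_rgt0 // lt0r -expr2 sqr_ge0 expf_neq0.
Qed.

Variable T : finType.
Implicit Types A B : T -> T -> int.

Definition psd A : Prop :=
  (forall i j, A i j = A j i) /\
  forall c : T -> int, 0 <= \sum_i \sum_j c i * c j * A i j.

(** After multiplication by the pivot, the value of the new form at [c] is the value of [A] at
    [a c - l e]: the projection of [c] away from the [k]-th unit vector [e], cleared of
    denominators. *)
Lemma psd_Schur_complement A k : psd A -> 0 < A k k ->
  psd (fun i j => A k k * A i j - A i k * A j k).
Proof.
move=> [sA pA] ak; split=> [i j|c]; first by rewrite sA [A i k * _]mulrC.
pose q := \sum_i \sum_j c i * c j * A i j; pose a := A k k.
pose l := \sum_i c i * A i k.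
have lE : \sum_i \sum_j c i * c j * (A i k * A j k) = l * l.
  rewrite /l mulr_suml; apply: eq_bigr => i _; rewrite mulr_sumr.
  by apply: eq_bigr => j _; ring.
have -> : \sum_i \sum_j c i * c j * (A k k * A i j - A i k * A j k) =
          a * q - l * l.
  rewrite -lE /q mulr_sumr -sumrB; apply: eq_bigr => i _.
  by rewrite mulr_sumr -sumrB; apply: eq_bigr => j _; rewrite /a; ring.
rewrite -(pmulr_rge0 _ ak) -/a.
pose e i : int := (i == k)%:R.
have eS (F : T -> int) : \sum_i e i * F i = F k.
  rewrite (bigD1 k) //= big1 ?addr0 => [|i /negbTE ik]; rewrite /e ?ik ?mul0r //.
  by rewrite eqxx mul1r.
have := pA (fun i => a * c i - l * e i).
suff -> : \sum_i \sum_j (a * c i - l * e i) * (a * c j - l * e j) * A i j =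
   a * (a * q - l * l) by [].
(* [g i] pairs the projected vector with the [i]-th unit vector; orthogonality to [e] is [gk]. *)
pose g i := a * (\sum_j c j * A i j) - l * A i k.
have gk : g k = 0.
  rewrite /g (_ : \sum_j c j * A k j = l) ?[l * _]mulrC ?subrr //.
  by apply: eq_bigr => j _; rewrite sA.
have gc : \sum_i c i * g i = a * q - l * l.
  rewrite /q {2}/l !mulr_sumr -sumrB; apply: eq_bigr => i _.
  rewrite /g mulrBr; congr (_ - _); last by ring.
  by rewrite !mulr_sumr; apply: eq_bigr => j _; ring.
transitivity (\sum_i (a * c i - l * e i) * g i).
  apply: eq_bigr => i _; rewrite /g -[A i k](eS (A i)) !mulr_sumr -sumrB mulr_sumr.
  by apply: eq_bigr => j _; ring.
transitivity (a * (\sum_i c i * g i) - l * (\sum_i e i * g i)).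
  by rewrite !mulr_sumr -sumrB; apply: eq_bigr => i _; ring.
by rewrite gc eS gk mulr0 subr0.
Qed.

Lemma psd_diag A k : psd A -> 0 <= A k k.
Proof.
case=> _ /(_ (fun i => (i == k)%:R)); rewrite (bigD1 k) //= (bigD1 k) //= eqxx.
rewrite !big1 ?addr0 ?mul1r // => i /negbTE ik; last by rewrite ik mulr0 mul0r.
by rewrite big1 // => j _; rewrite ik !mul0r.
Qed.

Lemma psd_row0 A k : psd A -> A k k = 0 -> forall i, A i k = 0.
Proof.
move=> [sA pA] ak i; apply/eqP/negPn/negP => aik.
have ik : i != k by apply: contraNneq aik => ->; rewrite ak.
(* With this [z] the form takes the value [A i i - 2 (A i i + 1) (A i k)^2] at [e_i + z e_k],
   negative because a nonzero integer has square at least 1. *)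
pose z := - (A i i + 1) * A i k.
pose c j : int := if j == i then 1 else if j == k then z else 0.
have cS (F : T -> int) : \sum_j c j * F j = F i + z * F k.
  rewrite (bigD1 i) //= (bigD1 k) 1?eq_sym //= big1 => [|j /andP[ji jk]].
    by rewrite /c eqxx eq_sym (negbTE ik) eqxx mul1r addr0.
  by rewrite /c (negbTE ji) (negbTE jk) mul0r.
have aii : 0 <= A i i by apply: psd_diag.
have aik1 : 1 <= A i k * A i k.
  by rewrite -gtz0_ge1 lt0r -expr2 sqr_ge0 expf_neq0.
have := pA c.
have -> : \sum_i \sum_j c i * c j * A i j = A i i + z * A i k + z * A i k.
  transitivity (\sum_i' c i' * (A i' i + z * A i' k)).
    apply: eq_bigr => i' _; rewrite -(cS (A i')) mulr_sumr.
    by apply: eq_bigr => j _; rewrite mulrA.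
  by rewrite cS ak [A k i]sA; ring.
by rewrite /z => H; nra.
Qed.

(** A consequence of Schur's product theorem. Peel a rank one matrix off [A k k * A]: it contributes
    the value of [B] at column [k] of [A], and the Schur complement that remains has fewer nonzero
    diagonal entries, since zero ones stay zero by [psd_row0]. *)
Lemma psd_sum_ge0 A B : psd A -> psd B -> 0 <= \sum_i \sum_j A i j * B i j.
Proof.
move=> + pB; have [N] := ubnP #|[pred k | A k k != 0]|.
elim: N A => // N IH A ltN pA.
case: (pickP [pred k | A k k != 0]) => [k /= ak0|A0]; last first.
  rewrite big1 // => i _; rewrite big1 // => j _.
  by rewrite (psd_row0 pA) ?mul0r //; apply/eqP/negbFE/A0.
have ak : 0 < A k k by rewrite lt0r ak0; apply: psd_diag.
have pS := psd_Schur_complement pA ak.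
rewrite -(pmulr_rge0 _ ak).
have -> : A k k * (\sum_i \sum_j A i j * B i j) =
    \sum_i \sum_j (A k k * A i j - A i k * A j k) * B i j +
    \sum_i \sum_j A i k * A j k * B i j.
  rewrite mulr_sumr -big_split; apply: eq_bigr => i _ /=.
  by rewrite mulr_sumr -big_split; apply: eq_bigr => j _ /=; ring.
rewrite addr_ge0 //; last by case: pB.
apply: IH pS; rewrite -ltnS; apply: leq_trans ltN; rewrite ltnS.
apply: proper_card; apply/properP; split; last first.
  by exists k; rewrite !inE // subrr eqxx.
apply/subsetP=> i; rewrite !inE; apply: contraNneq => ai.
by rewrite ai (proj1 pA i k) (psd_row0 pA ai) !mulr0 subrr.
Qed.

End PositiveMatrices.

(** Most maps below are additive only under a lattice hypothesis, so the structure is built on the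
    spot to reach [raddf_sum] and [raddfMz]. *)
Definition additive_of (U V : zmodType) (f : U -> V) (fB : zmod_morphism f) :
  {additive U -> V} := HB.pack f (GRing.isZmodMorphism.Build U V f fB).

(** * The ring Z<G>: trace, involution and the basis of coset representatives *)

Section ModifiedGroupRingTheory.
Variables (gT : finGroupType) (cG : abelian [set: gT]).
Variables (u : gT) (ou : #[u]%g = 2%N).
Local Notation ZG := (group_ring cG).
Local Notation A := (zg cG ou).
Local Notation of_ := (zg_of cG ou).
Local Notation cosu := (rcosets <[u]>%g [set: gT]).
Local Notation n := #|gT|./2.
Implicit Types (r : A) (s t : gT).

Lemma zg_t_is_additive : zmod_morphism (@zg_t _ cG _ ou).
Proof.
elim/quotW=> a; elim/quotW=> b; rewrite -(raddfB \pi_A) !zg_t_pi /gr_t !gr_subE.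
by ring.
Qed.
HB.instance Definition _ :=
  GRing.isZmodMorphism.Build A int (@zg_t _ cG _ ou) zg_t_is_additive.

Lemma zg_bar_is_additive : zmod_morphism (@zg_bar _ cG _ ou).
Proof.
elim/quotW=> a; elim/quotW=> b; rewrite -(raddfB \pi_A) !zg_bar_pi.
rewrite -(raddfB \pi_A); congr (\pi_A _); apply/ffunP=> s.
by rewrite gr_subE !gr_barE gr_subE.
Qed.
HB.instance Definition _ :=
  GRing.isZmodMorphism.Build A A (@zg_bar _ cG _ ou) zg_bar_is_additive.

Lemma zg_barK : involutive (@zg_bar _ cG _ ou).
Proof.
move=> r; elim/quotW: r => a; rewrite [zg_bar (\pi_A a)]zg_bar_pi zg_bar_pi.
congr (\pi_A _); apply/ffunP=> s.
by rewrite !gr_barE invgK.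
Qed.

Lemma zg_t_bar r : zg_t (zg_bar r) = zg_t r.
Proof.
by elim/quotW: r => a; rewrite zg_bar_pi !zg_t_pi /gr_t !gr_barE invg1 (invgu ou).
Qed.

Lemma zg_bar_of s : zg_bar (of_ s) = of_ s^-1%g.
Proof.
rewrite zg_bar_pi; congr (\pi_A _); apply/ffunP=> x; rewrite !ffunE.
by rewrite (inv_eq invgK).
Qed.

Lemma zg_of1 : of_ 1%g = 1.
Proof. by rewrite -(rmorph1 \pi_A). Qed.

Lemma zg_additive_eq (V : zmodType) (f g : A -> V) :
  zmod_morphism f -> zmod_morphism g -> (forall s, f (of_ s) = g (of_ s)) ->
  f =1 g.
Proof.
move=> fB gB fg; move=> r; elim/quotW: r => a; rewrite zg_sum.
rewrite -[LHS]/(additive_of fB _) -[RHS]/(additive_of gB _) !raddf_sum.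
by apply: eq_bigr => s _; rewrite !raddfMz /= fg.
Qed.

Lemma zg_barM r r' : zg_bar (r * r') = zg_bar r * zg_bar r'.
Proof.
move: r; apply: zg_additive_eq => [x y|x y|s]; rewrite ?mulrBl ?raddfB ?mulrBl //.
move: r'; apply: zg_additive_eq => [x y|x y|s']; rewrite ?mulrBr ?raddfB ?mulrBr //.
by rewrite -zg_ofM !zg_bar_of -zg_ofM invMg (abelian_mulgC cG).
Qed.

Lemma zg_t_of s : zg_t (of_ s) = (s == 1%g)%:R - (s == u)%:R.
Proof. by rewrite zg_t_pi /gr_t !ffunE ![_ == s]eq_sym. Qed.

Let X := transversal cosu [set: gT].

Lemma mem_transversal_u s : ((u * s)%g \in X) = (s \notin X).
Proof.
have /and3P[_ _ /forallP/(_ (<[u]> :* s)%g)/implyP trX] :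
    is_transversal X cosu [set: gT].
  by apply/transversalP/rcosets_partition/subsetT.
have us : (u * s != s)%g.
  by rewrite -{2}[s]mul1g (inj_eq (mulIg s)) -order_gt1 ou.
have cE : (<[u]> :* s)%g = [set s; (u * s)%g].
  apply/setP=> x; rewrite !inE; apply/rcosetP/orP => [[y /cycleP[i ->] ->]|].
    elim: i => [|i IH]; first by rewrite expg0 mul1g eqxx; left.
    rewrite expgS -mulgA; case: IH => /eqP ->; [by right|left].
    by rewrite mulgA (mulguu ou) mul1g.
  by case=> /eqP ->; [exists 1%g; rewrite ?group1 ?mul1g | exists u; rewrite ?cycle_id].
have /trX : (<[u]> :* s)%g \in cosu by apply/rcosetsP; exists s.
rewrite cE; case sX: (s \in X); case uX: ((u * s)%g \in X) => //.
  rewrite (_ : _ :&: _ = [set s; (u * s)%g]) ?cards2 1?[s == _]eq_sym ?us //.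
  by apply/setIidPr/subsetP => x /set2P[] ->.
rewrite (_ : _ :&: _ = set0) ?cards0 //; apply/setP=> x; rewrite !inE.
by apply/negP => /andP[xX /orP[]/eqP xE]; rewrite xE ?sX ?uX in xX.
Qed.

Lemma big_transversal (V : zmodType) (F : gT -> V) :
  \sum_s F s = \sum_(s in X) (F s + F (u * s)%g).
Proof.
rewrite [RHS]big_split [LHS](bigID (mem X)) /=; congr (_ + _).
rewrite (reindex_inj (mulgI u)); apply: eq_bigl => s /=.
by rewrite mem_transversal_u negbK.
Qed.

Lemma card_cosu : #|X| = n.
Proof.
have trX := transversalP (rcosets_partition (subsetT <[u]>%g)).
rewrite (card_transversal trX).
by rewrite -/(indexg _ _) -divgS ?subsetT // -orderE ou cardsT divn2.
Qed.

Definition sg (i : 'I_n) : gT := enum_val (cast_ord (esym card_cosu) i).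

Lemma big_sg (V : zmodType) (F : gT -> V) :
  \sum_s F s = \sum_i (F (sg i) + F (u * sg i)%g).
Proof.
rewrite big_transversal big_enum_val /=.
rewrite (reindex (cast_ord (esym card_cosu))) //=.
by exists (cast_ord card_cosu) => i _; rewrite ?cast_ordK ?cast_ordKV.
Qed.

(** The value -1 cannot occur, since [sg j = u * sg i] would put two elements of one coset into the
    transversal. So the representatives are orthonormal for the standard form. *)
Lemma zg_t_sg i j : zg_t (of_ (sg i)^-1 * of_ (sg j)) = (i == j)%:R.
Proof.
have sgX k : sg k \in X by apply: enum_valP.
have sgI : injective sg by move=> k l /enum_val_inj/cast_ord_inj.
rewrite -zg_ofM zg_t_of -eq_mulVg1 (inj_eq sgI).
case: (_ =P u) => [ju|_]; last by rewrite subr0.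
have := mem_transversal_u (sg i).
by rewrite -ju [(_ * sg i)%g](abelian_mulgC cG) mulKVg !sgX.
Qed.

Lemma zg_t_ofM s (a : ZG) : zg_t (of_ s * \pi_A a) = a s^-1%g - a (s^-1 * u)%g.
Proof.
rewrite -(rmorphM \pi_A) zg_t_pi -[gr_of cG s * a]/(gr_mul (gr_of cG s) a).
by rewrite /gr_t !gr_mulE mulg1.
Qed.

Lemma zg_expand r : r = \sum_i of_ (sg i) *~ zg_t (of_ (sg i)^-1 * r).
Proof.
elim/quotW: r => a; rewrite {1}zg_sum big_sg; apply: eq_bigr => i _.
rewrite zg_t_ofM invgK mulrzBr zg_ofM zg_of_u mulN1r mulNrz.
by rewrite (abelian_mulgC cG).
Qed.

(** The coordinates in [zg_expand] are such traces. Since the trace of a lifted form is the form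
    itself, this reduces identities between lifted forms to identities between integers. *)
Lemma zg_eqP r r' : (forall s, zg_t (of_ s * r) = zg_t (of_ s * r')) -> r = r'.
Proof.
by move=> rr'; rewrite [r]zg_expand [r']zg_expand; apply: eq_bigr => i _; rewrite rr'.
Qed.

Lemma zg_divisible (m : int) r :
  (forall i, exists q, zg_t (of_ (sg i)^-1 * r) = m * q) ->
  exists r', r = r' *~ m.
Proof.
move=> /choice[q qE]; exists (\sum_i of_ (sg i) *~ q i).
rewrite mulrz_suml [LHS]zg_expand; apply: eq_bigr => i _.
by rewrite qE mulrzA_C.
Qed.

Lemma zbasis_zg : zbasis (fun i => of_ (sg i)).
Proof.
apply: zbasisP => [r|c c0].
  exists [ffun i => zg_t (of_ (sg i)^-1 * r)]; rewrite [LHS]zg_expand.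
  by apply: eq_bigr => i _; rewrite ffunE.
apply/ffunP=> i; rewrite ffunE.
have := congr1 (fun r => zg_t (of_ (sg i)^-1 * r)) c0.
rewrite mulr0 raddf0 mulr_sumr raddf_sum (bigD1 i) //= big1 => [|j ji].
  by rewrite mulrzAr raddfMz /= zg_t_sg eqxx addr0 intz.
by rewrite mulrzAr raddfMz /= zg_t_sg eq_sym (negbTE ji) mul0rz.
Qed.

End ModifiedGroupRingTheory.

(** * G-lattices as Z<G>-modules; generators modulo m and their duals *)

Section LatticeTheory.
Variables (gT : finGroupType) (cG : abelian [set: gT]).
Variables (u : gT) (ou : #[u]%g = 2%N).
Local Notation A := (zg cG ou).
Local Notation of_ := (zg_of cG ou).
Local Notation sg := (sg ou).
Local Notation n := #|gT|./2.
Variables (L : gdata gT) (hL : is_glattice u L).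
Local Notation lift_form := (@lift_form _ cG u ou L).
Implicit Types (r : A) (s : gT) (x y z : L).

Lemma zg_act_is_additive r : zmod_morphism (@zg_act _ cG u ou L r).
Proof.
move=> x y; rewrite /zg_act /lincomb -sumrB; apply: eq_bigr => s _.
by rewrite (glact_is_additive hL) mulrzBl.
Qed.

Lemma zg_actl_is_additive x : zmod_morphism (fun r => zg_act r x).
Proof.
move=> r r'; elim/quotW: r => a; elim/quotW: r' => a'.
rewrite -(raddfB \pi_A) !(zg_act_pi _ _ _ hL) -sumrB; apply: eq_bigr => s _.
by rewrite gr_subE mulrzBr.
Qed.

Lemma zg_act_of s x : zg_act (of_ s) x = glact s x.
Proof.
rewrite (zg_act_pi _ _ _ hL) (bigD1 s) //= big1 ?addr0 => [|t /negbTE ts].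
  by rewrite ffunE eqxx mulr1z.
by rewrite ffunE ts mulr0z.
Qed.

Lemma zg_act1 x : zg_act (1 : A) x = x.
Proof. by rewrite -zg_of1 zg_act_of (glact1 hL). Qed.

Lemma zg_actM r r' x : zg_act (r * r') x = zg_act r (zg_act r' x).
Proof.
move: r; apply: zg_additive_eq => [a b|a b|s]; first 2 last.
- move: r'; apply: zg_additive_eq => [a b|a b|t].
  + by rewrite mulrBr (zg_actl_is_additive x).
  + by rewrite (zg_actl_is_additive x) (zg_act_is_additive _).
  + by rewrite -zg_ofM !zg_act_of (glactM hL).
- by rewrite mulrBl (zg_actl_is_additive x).
- by rewrite (zg_actl_is_additive _ a b).
Qed.

Lemma zg_actMz r x (k : int) : zg_act r (x *~ k) = zg_act r x *~ k.
Proof. exact: (raddfMz (additive_of (zg_act_is_additive r))). Qed.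

Lemma zg_actlMz r x (k : int) : zg_act (r *~ k) x = zg_act r x *~ k.
Proof. exact: (raddfMz (additive_of (zg_actl_is_additive x))). Qed.

Lemma lift_formMzl x y (k : int) : lift_form (x *~ k) y = lift_form x y *~ k.
Proof. exact: (raddfMz (additive_of (lift_forml_is_additive cG ou hL y))). Qed.

Lemma zg_act_sg r x :
  zg_act r x = \sum_i glact (sg i) x *~ zg_t (of_ (sg i)^-1 * r).
Proof.
rewrite {1}[r]zg_expand -[LHS]/(additive_of (zg_actl_is_additive x) _).
by rewrite raddf_sum; apply: eq_bigr => i _; rewrite raddfMz /= zg_act_of.
Qed.

Lemma zg_t_lift_form x y : zg_t (lift_form x y) = glform x y.
Proof.
(* A sum over all of G that folds along the pairs [s], [u * s]: since [u] acts as -1, the folded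
   term is [zg_t (of_ s)] times the form value. *)
pose F s : int := (s == 1%g)%:R * glform x (glact s y).
have -> : glform x y = \sum_s F s.
  rewrite (bigD1 1%g) //= big1 => [|s /negbTE s1]; rewrite /F ?s1 ?mul0r //.
  by rewrite eqxx mul1r (glact1 hL) addr0.
rewrite (big_transversal ou) raddf_sum; apply: eq_bigr => s _.
rewrite raddfMz /= zg_t_of /F (glactM hL) (glact_u hL) (glformNr hL).
have -> : ((u * s)%g == 1%g) = (s == u).
  by rewrite -eq_invg_mul (invgu ou) eq_sym.
by rewrite mulrzz; ring.
Qed.

Lemma zg_t_of_lift_form s x y :
  zg_t (of_ s * lift_form x y) = glform (glact s x) y.
Proof. by rewrite -(lift_form_actl cG ou hL) zg_t_lift_form. Qed.

Lemma glform_actV s x y : glform (glact s^-1%g x) y = glform x (glact s y).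
Proof. by rewrite -(glact_isom hL s) -(glactM hL) mulgV (glact1 hL). Qed.

Lemma zg_bar_lift_form x y : zg_bar (lift_form x y) = lift_form y x.
Proof.
apply: zg_eqP => s; rewrite zg_t_of_lift_form -[of_ s]zg_barK zg_bar_of.
by rewrite -zg_barM zg_t_bar zg_t_of_lift_form glform_actV (glform_sym hL).
Qed.

Lemma glformMzl x y (k : int) : glform (x *~ k) y = glform x y *~ k.
Proof. exact: (raddfMz (additive_of (glforml_is_additive hL y))). Qed.

Lemma glformMzr x y (k : int) : glform x (y *~ k) = glform x y *~ k.
Proof. exact: (raddfMz (additive_of (glformr_is_additive hL x))). Qed.

Lemma glform0l y : glform 0 y = 0.
Proof. exact: (raddf0 (additive_of (glforml_is_additive hL y))). Qed.

Lemma lattice_torsion_free x (d : int) : x *~ d = 0 -> d != 0 -> x = 0.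
Proof.
move=> xd d0; apply/eqP/negPn/negP => /(glform_gt0 hL).
have /esym/eqP := glformMzl x x d.
by rewrite xd glform0l mulrz_eq0 (negbTE d0) /= => /eqP ->.
Qed.

Lemma gram_mxfam k (b : 'I_k -> L) p q (P : 'M[int]_(p, k)) (Q : 'M[int]_(q, k)) i j :
  glform (mxfam P b i) (mxfam Q b j) = (P *m gram b *m Q^T) i j.
Proof.
rewrite -[LHS]/(additive_of (glformr_is_additive hL _) _) raddf_mxfam mxE.
apply: eq_bigr => l _ /=; rewrite [Q^T l j]mxE -mulrzr intz; congr (_ * _).
rewrite -[LHS]/(additive_of (glforml_is_additive hL _) _) raddf_mxfam mxE.
by apply: eq_bigr => l' _ /=; rewrite mxE -mulrzr intz mulrC.
Qed.

Definition gen_mod (m : nat) (e : L) : Prop :=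
  forall x, exists r y, x = zg_act r e + y *+ m.

Lemma zg_act_lincomb (c : {ffun gT -> int}) x :
  lincomb (fun s => glact s x) c = zg_act (\pi_A c) x.
Proof. by rewrite (zg_act_pi _ _ _ hL). Qed.

Lemma gen_modP (m : nat) (e : L) :
  gen_mod m e <->
  forall x, exists c y, x = lincomb (fun s => glact s e) c + y *+ m.
Proof.
split=> eP x.
  have [r [y ->]] := eP x; exists (generic_quotient.repr r : group_ring cG), y.
  by [].
by have [c [y ->]] := eP x; exists (\pi_A c), y; rewrite zg_act_lincomb.
Qed.

(** [Q] records how the basis is written in translates of [e] modulo m. The size [k] is left free,
    so that m = 2 also yields [k <= n]. *)
Lemma gen_mod_mx k (b : 'I_k -> L) (m : nat) e (P : 'M[int]_(n, k)) :
  zbasis b -> gen_mod m e -> (fun i => glact (sg i) e) =1 mxfam P b ->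
  exists Q Y, Q *m P = 1%:M + m%:Z *: Y.
Proof.
move=> zb eP PE.
have /choice[ry ryE] : forall j, exists p : A * L, b j = zg_act p.1 e + p.2 *+ m.
  by move=> j; have [r [y ?]] := eP (b j); exists (r, y).
have [Y YE] := mxfam_choose (fun j => (ry j).2) (zbasis_gen zb).
exists (\matrix_(j, i) zg_t (of_ (sg i)^-1 * (ry j).1)), (- Y).
rewrite scalerN; apply/(canRL (addrK _))/(zbasis_mx_inj zb) => j.
rewrite mxfam1 mxfamD mxfamZ -YE mxfam_mul -pmulrn [RHS]ryE zg_act_sg.
by congr (_ + _); apply: eq_bigr => i _; rewrite -PE mxE.
Qed.

(* The translates of [e] form a basis of L/mL, so unimodularity provides an
   element whose form values on them are prescribed modulo m. *)
Lemma gen_mod_dual (b : 'I_n -> L) (m : nat) (e : L) :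
  zbasis b -> \det (gram b) = 1 -> gen_mod m e ->
  exists y r, lift_form e y = 1 + r *+ m.
Proof.
move=> zb db eP; pose f i := glact (sg i) e.
have [P PE] := mxfam_choose f (zbasis_gen zb).
have [Q [Y QP]] := gen_mod_mx zb eP PE.
have [q dE] : congz m%:Z (\det P * \det Q) 1.
  by rewrite mulrC -det_mulmx QP; apply: congz_det1.
(* The prescribed values: those which [e . \bar y = 1] would force. In [w], the adjugate of the Gram
   matrix is its inverse and [\det Q *: \adj P] inverts [P] modulo m. *)
pose v : 'cV[int]_n := \col_i zg_t (of_ (sg i)).
pose w := \adj (gram b) *m (\adj P *m (\det Q *: v)).
pose y := mxfam w^T b 0.
have yE i : glform (f i) y = v i 0 + m%:Z * (q * v i 0).
  rewrite PE gram_mxfam trmxK -mulmxA [gram b *m _]mulmxA mul_mx_adj db mul1mx.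
  rewrite mulmxA mul_mx_adj mul_scalar_mx scalerA dE mxE; ring.
have [r rE] : exists r, zg_bar (lift_form e y - 1) = r *~ m%:Z.
  apply: zg_divisible => i; exists (q * v i 0).
  rewrite -zg_bar_of -zg_barM zg_t_bar mulrBr mulr1 raddfB /= zg_t_of_lift_form.
  by rewrite yE mxE addrC addKr.
exists y, (zg_bar r); rewrite pmulrn -raddfMz /= -rE zg_barK.
by rewrite addrC subrK.
Qed.

End LatticeTheory.

(** * Invertible lattices: trace ideal and rank one *)

Section InvertibleTheory.
Variables (gT : finGroupType) (cG : abelian [set: gT]).
Variables (u : gT) (ou : #[u]%g = 2%N).
Local Notation A := (zg cG ou).
Local Notation of_ := (zg_of cG ou).
Variables (L : gdata gT) (iL : invertible u L).
Local Notation lift_form := (@lift_form _ cG u ou L).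
Implicit Types (r : A) (x y z : L).

Let hL : is_glattice u L. Proof. by case: iL. Qed.

(** A generator modulo m together with a dual element is data that passes to tensor products;
    [invertible_of_local] is the converse. *)
Lemma invertible_local (m : nat) : (0 < m)%N ->
  exists e y : L, gen_mod cG ou m e /\ exists r, lift_form e y = 1 + r *+ m.
Proof.
case: iL => _ [b [zb db]] gL /gL[e /(gen_modP cG ou hL) eP].
by have [y yP] := gen_mod_dual hL zb db eP; exists e, y.
Qed.

Lemma zg_fin_gen : fin_gen A.
Proof. by exists #|gT|./2, (fun i => of_ (sg ou i)); apply/zbasis_gen/zbasis_zg. Qed.

(* The trace ideal I satisfies I + mA = A for all m; m = 2 gives an odd N in I,
   and then m = N gives I = A. *)
Lemma lift_form_partition_of_unity :
  exists s : seq (L * L), \sum_(p <- s) lift_form p.1 p.2 = 1.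
Proof.
pose W r := exists s : seq (L * L), r = \sum_(p <- s) lift_form p.1 p.2.
have W0 : W 0 by exists [::]; rewrite big_nil.
have WB r r' : W r -> W r' -> W (r - r').
  move=> [s ->] [s' ->]; exists (s ++ [seq (- p.1, p.2) | p <- s']).
  rewrite big_cat big_map; congr (_ + _); rewrite -sumrN; apply: eq_bigr => p _.
  by rewrite -[- p.1]mulrN1z lift_formMzl // mulrN1z.
have WT m : (0 < m)%N -> forall r, exists w (y : A), W w /\ r = w + y *+ m.
  move=> /invertible_local[e [y [_ [r' yE]]]] r; exists (r * lift_form e y), (- (r * r')).
  split; last by rewrite yE mulrDr mulr1 mulrnAr mulNrn addrK.
  by exists [:: (zg_act r e, y)]; rewrite big_seq1 (lift_form_zgl hL).
have [N [q NE] WN] := subgroup_mod_cofinite zg_fin_gen W0 WB (WT 2%N isT).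
have N0 : (0 < `|N|)%N by lia.
have [w [y [Ww oneE]]] := WT _ N0 1.
have : W 1; last by case=> s; exists s.
have Wy : W (y *+ `|N|).
  (* The modulus is a natural number whereas [WN] concerns the signed [N], hence two cases. *)
  have [->|->] : y *+ `|N| = y *~ N \/ y *+ `|N| = 0 - y *~ N; first 1 last.
  - exact: WN.
  - exact: (WB _ _ W0 (WN y)).
  - case: (intP N) => [|k|k]; [by left|by left|right].
    by rewrite abszN mulrNz sub0r opprK.
rewrite oneE -[y *+ _]opprK; apply: (WB _ _ Ww); rewrite -sub0r; exact: (WB _ _ W0 Wy).
Qed.

(* L has rank one: after multiplication by an odd integer both sides become
   multiples of one element. *)
Lemma lift_form_swap x y z :
  zg_act (lift_form x y) z = zg_act (lift_form z y) x.
Proof.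
have [e [_ [eP _]]] := invertible_local (isT : (0 < 2)%N).
pose W x := exists r, x = zg_act r e.
have W0 : W 0 by exists 0; apply/esym/(raddf0 (additive_of (zg_actl_is_additive hL e))).
have WB x1 x2 : W x1 -> W x2 -> W (x1 - x2).
  by case=> r1 -> [r2 ->]; exists (r1 - r2); rewrite (zg_actl_is_additive hL e).
have [|N [q NE] WN] := subgroup_mod_cofinite (m := 2) (glat_fin_gen hL) W0 WB.
  by move=> x1; have [r [y1 ->]] := eP x1; exists (zg_act r e), y1; split=> //; exists r.
have N0 : N * N != 0 by rewrite mulf_eq0 negb_or; apply/andP; split; lia.
have [[r xE] [r' zE]] := (WN x, WN z).
(* Both sides are biadditive in [x] and [z], so a factor [N * N] lets both be replaced by multiples
   of [e]; L has no torsion. *)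
apply/eqP; rewrite -subr_eq0; apply/eqP/(lattice_torsion_free hL _ N0).
have act2 x1 z1 : zg_act (lift_form x1 y) z1 *~ (N * N) =
                  zg_act (lift_form (x1 *~ N) y) (z1 *~ N).
  by rewrite lift_formMzl // zg_actlMz // zg_actMz // mulrzA.
rewrite mulrzBl !act2 xE zE !(lift_form_zgl hL) -!(zg_actM hL).
by rewrite mulrAC [r' * _ * r]mulrAC [r' * r]mulrC subrr.
Qed.

End InvertibleTheory.

(** * Rank and determinant from local data *)

Section LocalCriterion.
Variables (gT : finGroupType) (cG : abelian [set: gT]).
Variables (u : gT) (ou : #[u]%g = 2%N).
Local Notation A := (zg cG ou).
Local Notation of_ := (zg_of cG ou).
Local Notation sg := (sg ou).
Local Notation n := #|gT|./2.
Variables (L : gdata gT) (hL : is_glattice u L).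
Local Notation lift_form := (@lift_form _ cG u ou L).

Lemma gram_posdefmx k (b : 'I_k -> L) : zbasis b -> posdefmx (gram b).
Proof.
move=> zb x x0; rewrite -(gram_mxfam hL); apply: (glform_gt0 hL).
apply: contraNneq x0 => bx0; apply/eqP/(zbasis_mx_inj zb) => i.
by rewrite ord1 bx0 [RHS]big1 // => j _; rewrite mxE mulr0z.
Qed.

Lemma gram_sym k (b : 'I_k -> L) : (gram b)^T = gram b.
Proof. by apply/matrixP=> i j; rewrite !mxE (glform_sym hL). Qed.

(** The translates of [e] and [y] are dual modulo m because the form of [sg i e] and [sg j y] is the
    trace of [(sg j)^-1 (sg i) (e . \bar y)]. For m = 2 this gives [n <= k]; for [k = n] it makes
    the Gram determinant invertible modulo m. *)
Lemma dual_mod_mx k (b : 'I_k -> L) (m : nat) e y (r : A) :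
  zbasis b -> lift_form e y = 1 + r *+ m ->
  exists (P H : 'M[int]_(n, k)) X,
    (fun i => glact (sg i) e) =1 mxfam P b /\
    P *m gram b *m H^T = 1%:M + m%:Z *: X.
Proof.
move=> /zbasis_gen gb yE.
have [P PE] := mxfam_choose (fun i => glact (sg i) e) gb.
have [H HE] := mxfam_choose (fun i => glact (sg i) y) gb.
exists P, H, (\matrix_(i, j) zg_t (of_ (sg j)^-1 * of_ (sg i) * r)).
split=> //; apply/matrixP=> i j; rewrite -(gram_mxfam hL) -PE -HE.
rewrite -(zg_t_of_lift_form cG ou hL) (lift_form_actr cG ou hL) yE !mxE.
rewrite mulrCA mulrA mulrDr mulr1 mulrnAr raddfD raddfMn /= zg_t_sg [j == i]eq_sym.
by congr (_ + _); rewrite -mulr_natl natz.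
Qed.

Lemma mulmx1_mod2_min p q (P : 'M[int]_(p, q)) (Q : 'M[int]_(q, p)) X :
  P *m Q = 1%:M + 2%:Z *: X -> (p <= q)%N.
Proof.
move/(congr1 (map_mx (intr : int -> 'F_2))).
rewrite map_mxM map_mxD map_scalar_mx map_mxZ /= rmorph1.
rewrite (_ : 2%:~R = 0) ?scale0r ?addr0; last by apply/val_inj.
exact: mulmx1_min.
Qed.

Lemma invertible_of_local :
  (forall m, (0 < m)%N -> exists e y : L,
     gen_mod cG ou m e /\ exists r, lift_form e y = 1 + r *+ m) ->
  invertible u L.
Proof.
move=> loc.
have [k [b zb]] := fin_gen_zbasis (glat_fin_gen hL) (@lattice_torsion_free _ _ _ hL).
have kn : k = n.
  have [e [y [eP [r yE]]]] := loc 2%N isT.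
  have [P [H [X [PE PH]]]] := dual_mod_mx zb yE.
  have [Q [Y QP]] := gen_mod_mx hL zb eP PE.
  apply/eqP; rewrite eqn_leq (mulmx1_mod2_min QP).
  by rewrite -mulmxA in PH; rewrite (mulmx1_mod2_min PH).
subst k; split=> // [|m m0]; last first.
  by have [e [y [eP _]]] := loc m m0; exists e; apply/(gen_modP cG ou hL).
exists b; split=> //; set d := \det _.
have d0 : 0 < d by apply: posdefmx_det_gt0; [apply: gram_sym | apply: gram_posdefmx].
(* Taking the determinant itself as modulus turns the congruence into [d * z = 1]. *)
have [|e [y [_ [r yE]]]] := loc `|d|%N; first by lia.
have [P [H [X [_ PH]]]] := dual_mod_mx zb yE.
have [q] := congz_det1 `|d|%:Z X.
rewrite -PH !det_mulmx det_tr -/d gez0_abs ?ltW // => dE.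
have : d * (\det P * \det H - q) = 1.
  by rewrite mulrBr mulrA [d * _]mulrC dE addrK.
set z := _ - _ => dz; have z0 : 0 < z by rewrite -(pmulr_rgt0 _ d0) dz.
by apply/eqP; rewrite eq_le -gtz0_ge1 d0 -dz ler_peMr ?gtz0_ge1 // ltW.
Qed.

End LocalCriterion.

Lemma zmod_morphism_eq (V W : zmodType) (f g : V -> W) :
  f =1 g -> zmod_morphism f -> zmod_morphism g.
Proof. by move=> fg fB x y; rewrite -!fg fB. Qed.

(** * The tensor product: universal property and semidefinite form *)

Section TensorTheory.
Variables (gT : finGroupType) (cG : abelian [set: gT]).
Variables (u : gT) (ou : #[u]%g = 2%N).
Local Notation A := (zg cG ou).
Local Notation of_ := (zg_of cG ou).
Variables (L M : gdata gT).
Local Notation T := (tensor cG ou L M).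
Local Notation GT := (gtensor cG ou L M).
Local Notation tens := (@tens _ cG u ou L M).
Local Notation lift := (lift_form cG ou).
Local Notation tlift := (@tensor_lift _ cG u ou L M).
Implicit Types (r : A) (s : gT) (x y : L) (v w : M) (a b : T).

Lemma tensDl x y v : tens (x + y) v = tens x v + tens y v.
Proof.
apply/eqP; rewrite -subr_eq0 opprD addrA /tens -!(raddfB \pi_T).
exact/eqP/tensor_rel0/TensorDl.
Qed.

Lemma tensDr x v w : tens x (v + w) = tens x v + tens x w.
Proof.
apply/eqP; rewrite -subr_eq0 opprD addrA /tens -!(raddfB \pi_T).
exact/eqP/tensor_rel0/TensorDr.
Qed.

Lemma tensZ r x v : tens (zg_act r x) v = tens x (zg_act r v).
Proof.
apply/eqP; rewrite -subr_eq0 /tens -!(raddfB \pi_T).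
exact/eqP/tensor_rel0/TensorZ.
Qed.

Lemma tensl_is_additive v : zmod_morphism (tens^~ v).
Proof. by move=> x y; rewrite -[LHS](addrK (tens y v)) -tensDl subrK. Qed.

Lemma tensr_is_additive x : zmod_morphism (tens x).
Proof. by move=> v w; rewrite -[LHS](addrK (tens x w)) -tensDr subrK. Qed.

Lemma tensMzl x v (k : int) : tens (x *~ k) v = tens x v *~ k.
Proof. exact: (raddfMz (additive_of (tensl_is_additive v))). Qed.

Lemma tensMzr x v (k : int) : tens x (v *~ k) = tens x v *~ k.
Proof. exact: (raddfMz (additive_of (tensr_is_additive x))). Qed.

Lemma tensor_finsum a :
  exists k (x : 'I_k -> L) (v : 'I_k -> M), a = \sum_i tens (x i) (v i).
Proof.
elim/quotW: a => D; rewrite -[D]freeg_sumE raddf_sum (big_nth (0, 0)) big_mkord.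
set d := dom D.
exists (size d), (fun i => (nth (0, 0) d i).1 *~ coeff (nth (0, 0) d i) D).
exists (fun i => (nth (0, 0) d i).2); apply: eq_bigr => i _.
by rewrite tensMzl /tens -(raddfMz \pi_T) -surjective_pairing freegU_mulz intz.
Qed.

Lemma tensor_ind (P : T -> Prop) :
  P 0 -> (forall a b, P a -> P b -> P (a + b)) -> (forall x v, P (tens x v)) ->
  forall a, P a.
Proof.
by move=> P0 PD Pt a; have [k [x [v ->]]] := tensor_finsum a; apply: (big_ind P).
Qed.

Lemma tensor_additive_eq (V : zmodType) (f g : T -> V) :
  zmod_morphism f -> zmod_morphism g ->
  (forall x v, f (tens x v) = g (tens x v)) -> f =1 g.
Proof.
move=> fB gB fg; pose f' := additive_of fB; pose g' := additive_of gB.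
apply: tensor_ind => [|a b fga fgb|//].
  by rewrite -[f]/(f' : _ -> _) -[g]/(g' : _ -> _) !raddf0.
by rewrite -[f]/(f' : _ -> _) -[g]/(g' : _ -> _) !raddfD /= fga fgb.
Qed.

Lemma tensor_universal (V : zmodType) (f : L -> M -> V) :
  (forall v, zmod_morphism (f^~ v)) -> (forall x, zmod_morphism (f x)) ->
  (forall r x v, f (zg_act r x) v = f x (zg_act r v)) ->
  exists g : {additive T -> V}, forall x v, g (tens x v) = f x v.
Proof.
move=> fl fr fZ; pose F := free_ext (fun p : L * M => f p.1 p.2).
have FE D : F (generic_quotient.repr (\pi_T D)) = F D.
  apply: tensor_pi_eq => _ [x y v|x v w|r x v]; rewrite !raddfB /= !free_extU /=.
  - by rewrite -[f _ v]/(additive_of (fl v) _) raddfD /= addrAC addrK subrr.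
  - by rewrite -[f x _]/(additive_of (fr x) _) raddfD /= addrAC addrK subrr.
  - by rewrite fZ subrr.
pose G (a : T) := F (generic_quotient.repr a).
have GB : zmod_morphism G.
  move=> a b; elim/quotW: a => D; elim/quotW: b => E.
  by rewrite -(raddfB \pi_T) /G !FE /F raddfB.
by exists (additive_of GB) => x v; rewrite /= /G FE /F free_extU.
Qed.

(** Identifies the action on the tensor product, which is computed on representatives, with the
    additive map supplied by [tensor_universal]. *)
Lemma free_ext_repr (V : zmodType) (g : {additive T -> V}) a :
  free_ext (fun p => g (tens p.1 p.2)) (generic_quotient.repr a) = g a.
Proof.
rewrite -{2}[a]reprK -{2}[generic_quotient.repr a]freeg_sumE !raddf_sum.
apply: eq_bigr => p _ /=; rewrite -raddfMz /tens -(raddfMz \pi_T).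
by rewrite -surjective_pairing freegU_mulz intz.
Qed.

Variables (hL : is_glattice u L) (hM : is_glattice u M).

Lemma gtensor_act_is_additive s : zmod_morphism (@glact _ GT s).
Proof.
have [|||g gE] := @tensor_universal T (fun x v => tens (glact s x) v).
- by move=> v x y; rewrite (glact_is_additive hL) (tensl_is_additive v).
- by move=> x v w; apply: tensr_is_additive.
- by move=> r x v; rewrite -(zg_act_glact hL) tensZ.
apply: (zmod_morphism_eq (f := g)) => [a|]; last exact: raddfB.
by rewrite -free_ext_repr; apply: eq_bigr => p _; rewrite gE.
Qed.

Lemma tensor_liftl_is_additive b : zmod_morphism (tlift^~ b).
Proof.
move=> a a'; elim/quotW: a => D; elim/quotW: a' => D'; elim/quotW: b => E.
by rewrite -(raddfB \pi_T) !(tensor_lift_pi cG ou hL hM) raddfB.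
Qed.

Lemma tensor_liftr_is_additive a : zmod_morphism (tlift a).
Proof.
move=> b b'; elim/quotW: a => D; elim/quotW: b => E; elim/quotW: b' => E'.
rewrite -(raddfB \pi_T) !(tensor_lift_pi cG ou hL hM) /free_ext -sumrB.
apply: eq_bigr => p _; rewrite -mulrzBl; congr (_ *~ _).
exact: free_ext_is_additive.
Qed.

Lemma tensor_lift_actl s a b : tlift (glact s (a : GT)) b = of_ s * tlift a b.
Proof.
move: a; apply: tensor_additive_eq => [a a'|a a'|x v].
- by rewrite (gtensor_act_is_additive s) (tensor_liftl_is_additive b).
- by rewrite (tensor_liftl_is_additive b) mulrBr.
move: b; apply: tensor_additive_eq => [b b'|b b'|y w].
- exact: tensor_liftr_is_additive.
- by rewrite (tensor_liftr_is_additive _) mulrBr.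
by rewrite (glact_tens cG ou hL) !(tensor_lift_tens cG ou hL hM)
           (lift_form_actl cG ou hL) mulrA.
Qed.

Lemma zg_bar_tensor_lift a b : zg_bar (tlift a b) = tlift b a.
Proof.
move: a; apply: tensor_additive_eq => [a a'|a a'|x v].
- by rewrite (tensor_liftl_is_additive b) raddfB.
- exact: tensor_liftr_is_additive.
move: b; apply: tensor_additive_eq => [b b'|b b'|y w].
- by rewrite (tensor_liftr_is_additive _ b) raddfB.
- exact: tensor_liftl_is_additive.
by rewrite !(tensor_lift_tens cG ou hL hM) zg_barM !zg_bar_lift_form.
Qed.

Lemma tensor_lift_actr s a b : tlift a (glact s (b : GT)) = of_ s^-1%g * tlift a b.
Proof.
by rewrite -zg_bar_tensor_lift tensor_lift_actl zg_barM zg_bar_of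
           zg_bar_tensor_lift.
Qed.

Lemma gtensor_formE (a b : GT) : glform a b = zg_t (tlift a b).
Proof. by []. Qed.

Lemma gtensor_form_sym (a b : GT) : glform a b = glform b a.
Proof. by rewrite !gtensor_formE -[tlift b a]zg_bar_tensor_lift zg_t_bar. Qed.

Lemma gtensor_formr_is_additive (a : GT) : zmod_morphism (@glform _ GT a).
Proof.
by move=> b b'; rewrite !gtensor_formE (tensor_liftr_is_additive a) raddfB.
Qed.

Lemma gtensor_forml_is_additive (b : GT) : zmod_morphism ((@glform _ GT)^~ b).
Proof.
by move=> a a'; rewrite !gtensor_formE (tensor_liftl_is_additive b) raddfB.
Qed.

Lemma gtensor_fin_gen : fin_gen T.
Proof.
have [[k [b gb]] [l [c gc]]] := (glat_fin_gen hL, glat_fin_gen hM).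
pose B (i : 'I_(#|{: 'I_k * 'I_l}|)) : T :=
  tens (b (enum_val i).1) (c (enum_val i).2).
exists #|{: 'I_k * 'I_l}|, B; apply: tensor_ind => [|a a' [d ->] [d' ->]|x v].
- by exists 0; rewrite [RHS]big1 // => i _; rewrite ffunE mulr0z.
- exists (d + d'); rewrite -big_split; apply: eq_bigr => i _.
  by rewrite ffunE mulrzDr.
have [[p ->] [q ->]] := (gb x, gc v).
exists [ffun i => p (enum_val i).1 * q (enum_val i).2].
rewrite -[LHS]/(additive_of (tensl_is_additive _) _) raddf_sum /=.
transitivity (\sum_i \sum_j tens (b i) (c j) *~ (p i * q j)).
  apply: eq_bigr => i _.
  rewrite -[LHS]/(additive_of (tensr_is_additive _) _) raddf_sum /=.
  by apply: eq_bigr => j _; rewrite tensMzr tensMzl mulrzA.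
rewrite pair_bigA /= (reindex _ (onW_bij _ (@enum_val_bij _))) /=.
by apply: eq_bigr => i _; rewrite ffunE.
Qed.

Lemma glform_ge0 (N : gdata gT) (hN : is_glattice u N) (x : N) : 0 <= glform x x.
Proof.
have [->|/(glform_gt0 hN)/ltW//] := eqVneq x 0.
by rewrite (glform0l hN).
Qed.

Lemma psd_gram (N : gdata gT) (hN : is_glattice u N) (I : finType) (x : I -> N) :
  psd (fun i j => glform (x i) (x j)).
Proof.
split=> [i j|c]; first exact: (glform_sym hN).
have := glform_ge0 hN (\sum_i x i *~ c i).
rewrite -[glform _ _]/(additive_of (glforml_is_additive hN _) _) raddf_sum /=.
rewrite (eq_bigr (fun i => \sum_j c i * c j * glform (x i) (x j))) // => i _.
rewrite -[glform _ _]/(additive_of (glformr_is_additive hN _) _) raddf_sum /=.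
by apply: eq_bigr => j _; rewrite (glformMzl hN) (glformMzr hN) !mulrzz; ring.
Qed.

(** Expanding [x . \bar y] over a transversal gives one term per coset. In the sum over G the two
    signs from [u] cancel, so each coset counts twice. *)
Lemma zg_t_lift_formM x y v w :
  zg_t (lift x y * lift v w) *+ 2 =
  \sum_s glform x (glact s y) * glform v (glact s^-1%g w).
Proof.
rewrite (big_transversal ou) mulr_suml raddf_sum -sumrMnl /=.
apply: eq_bigr => s _; rewrite mulrzAl raddfMz /= (zg_t_of_lift_form cG ou hM).
rewrite -{1}[s]invgK (glform_actV hM) invMg [(s^-1 * _)%g](abelian_mulgC cG).
rewrite (invgu ou) !(glactM hL) !(glactM hM) (glact_u hL) (glact_u hM).
by rewrite (glformNr hL) (glformNr hM) mulrNN mulrzz mulr2n mulrC.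
Qed.

(* Averaging over (s, s^-1) acting on L x M writes the form as a Schur product
   of two Gram matrices. *)
Lemma gtensor_form_ge0 (a : GT) : 0 <= glform a a.
Proof.
rewrite gtensor_formE; have [k [x [v ->]]] := tensor_finsum a.
(* For each [s], the tensors of [X (s, i)] with [Y (s, i)] sum to the given element again. *)
pose X (p : gT * 'I_k) := glact p.1 (x p.2).
pose Y (p : gT * 'I_k) := glact p.1^-1%g (v p.2).
have := psd_sum_ge0 (psd_gram hL X) (psd_gram hM Y).
set S := \sum_p _; set a' := \sum_i _.
suff -> : S = (zg_t (tlift a' a') *+ 2) *+ #|gT|.
  by rewrite pmulrn_lge0 ?pmulrn_lge0 // (cardD1 1%g).
have -> : tlift a' a' = \sum_i \sum_j lift (x i) (x j) * lift (v i) (v j).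
  rewrite -[LHS]/(additive_of (tensor_liftl_is_additive _) _) raddf_sum /=.
  apply: eq_bigr => i _.
  rewrite -[LHS]/(additive_of (tensor_liftr_is_additive _) _) raddf_sum /=.
  by apply: eq_bigr => j _; rewrite (tensor_lift_tens cG ou hL hM).
rewrite -sumr_const /S.
rewrite -(pair_bigA _ (fun s i =>
  \sum_q glform (X (s, i)) (X q) * glform (Y (s, i)) (Y q))) /=.
apply: eq_bigr => s _; rewrite raddf_sum -sumrMnl; apply: eq_bigr => i _.
rewrite raddf_sum -sumrMnl /=.
rewrite -(pair_bigA _ (fun t j =>
  glform (X (s, i)) (X (t, j)) * glform (Y (s, i)) (Y (t, j)))) /=.
rewrite exchange_big; apply: eq_bigr => j _ /=.
(* The terms depend on [s^-1 t] only, so every [s] contributes the same amount. *)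
rewrite zg_t_lift_formM (reindex_inj (mulgI s)) /=; apply: eq_bigr => t _.
rewrite /X /Y /= invMg [(t^-1 * _)%g](abelian_mulgC cG) !(glactM hL) !(glactM hM).
by rewrite (glact_isom hL) (glact_isom hM).
Qed.

(** The degenerate case of Cauchy-Schwarz, needed while definiteness is still unknown. *)
Lemma gtensor_form0 (a b : GT) : glform a a = 0 -> glform a b = 0.
Proof.
move=> aa; apply/eqP/negPn/negP => ab0.
(* Makes the form at [b - k a] equal to [<b, b> - 2 (<b, b> + 1) <a, b>^2], which is negative. *)
pose k := (glform b b + 1) * glform a b.
have rMz (c d : GT) : glform c (d *~ k) = glform c d *~ k.
  exact: (raddfMz (additive_of (gtensor_formr_is_additive c))).
have lMz (c d : GT) : glform (d *~ k) c = glform d c *~ k.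
  exact: (raddfMz (additive_of (gtensor_forml_is_additive c))).
have := gtensor_form_ge0 (b - a *~ k).
rewrite (gtensor_forml_is_additive _ b) !(gtensor_formr_is_additive _ b).
rewrite !lMz !rMz aa [glform b a]gtensor_form_sym.
rewrite mul0rz !mulrzz.
have := gtensor_form_ge0 b; have : 1 <= glform a b * glform a b.
  by rewrite -gtz0_ge1 lt0r -expr2 sqr_ge0 expf_neq0.
by rewrite /k; nra.
Qed.

End TensorTheory.

(** * Tensor products of invertible lattices are invertible *)

Section TensorInvertible.
Variables (gT : finGroupType) (cG : abelian [set: gT]).
Variables (u : gT) (ou : #[u]%g = 2%N).
Local Notation A := (zg cG ou).
Local Notation of_ := (zg_of cG ou).
Variables (L M : gdata gT) (iL : invertible u L) (iM : invertible u M).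
Local Notation T := (tensor cG ou L M).
Local Notation GT := (gtensor cG ou L M).
Local Notation tens := (@tens _ cG u ou L M).
Local Notation lift := (lift_form cG ou).
Local Notation tlift := (@tensor_lift _ cG u ou L M).
Implicit Types (r : A) (s : gT) (x y : L) (v w : M).

Let hL : is_glattice u L. Proof. by case: iL. Qed.
Let hM : is_glattice u M. Proof. by case: iM. Qed.

(** Insert both partitions of unity into [x (x) v], then exchange by [lift_form_swap]:
    [(p.1 . \bar p.2) x = (x . \bar p.2) p.1], likewise in M. An element is thus determined by its
    lifted products with pure tensors. *)
Lemma tensor_expand (sL : seq (L * L)) (sM : seq (M * M)) :
  \sum_(p <- sL) lift p.1 p.2 = 1 -> \sum_(q <- sM) lift q.1 q.2 = 1 ->
  forall a : T, a = \sum_(p <- sL) \sum_(q <- sM)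
    tens (zg_act (tlift a (tens p.2 q.2)) p.1) q.1.
Proof.
move=> L1 M1; apply: tensor_additive_eq => [a b //|a b|x v].
  rewrite -sumrB; apply: eq_bigr => p _; rewrite -sumrB; apply: eq_bigr => q _.
  rewrite (tensor_liftl_is_additive hL hM _ a) (zg_actl_is_additive hL p.1).
  exact: tensl_is_additive.
transitivity (\sum_(p <- sL) \sum_(q <- sM)
    tens (zg_act (lift p.1 p.2) x) (zg_act (lift q.1 q.2) v)); last first.
  apply: eq_bigr => p _; apply: eq_bigr => q _.
  rewrite (lift_form_swap cG ou iL) (lift_form_swap cG ou iM) -tensZ -(zg_actM hL).
  by rewrite mulrC (tensor_lift_tens cG ou hL hM).
have eM p : \sum_(q <- sM) tens (zg_act (lift p.1 p.2) x) (zg_act (lift q.1 q.2) v)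
          = tens (zg_act (lift p.1 p.2) x) v.
  rewrite -[v in RHS](zg_act1 cG ou hM) -M1.
  rewrite -[zg_act (\sum_(_ <- _) _) v]/(additive_of (zg_actl_is_additive hM v) _).
  rewrite raddf_sum -[RHS]/(additive_of (tensr_is_additive cG ou _) _) raddf_sum.
  by [].
under eq_bigr do rewrite eM.
rewrite -[x in LHS](zg_act1 cG ou hL) -L1.
rewrite -[zg_act (\sum_(_ <- _) _) x]/(additive_of (zg_actl_is_additive hL x) _).
by rewrite raddf_sum -[LHS]/(additive_of (tensl_is_additive cG ou _) _) raddf_sum.
Qed.

Lemma gtensor_is_glattice : is_glattice u GT.
Proof.
have fB := @gtensor_forml_is_additive _ cG _ ou L M hL hM.
have gB := @gtensor_formr_is_additive _ cG _ ou L M hL hM.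
have aB := @gtensor_act_is_additive _ cG _ ou L M hL.
split.
- exact: gtensor_fin_gen.
- by move=> a b c; exact: (raddfD (additive_of (fB c)) a b).
- by move=> a b c; exact: (raddfD (additive_of (gB a)) b c).
- exact: gtensor_form_sym.
- move=> a; rewrite lt_def (gtensor_form_ge0 hL hM) andbT; apply: contraNneq => aa.
  have [[sL L1] [sM M1]] := (lift_form_partition_of_unity cG ou iL,
                             lift_form_partition_of_unity cG ou iM).
  rewrite (tensor_expand L1 M1 a) big1 // => p _; rewrite big1 // => q _.
  (* The traces of its multiples by group elements are form values of [a] against translates, zero
     because [a] is a null vector. *)
  have -> : tlift a (tens p.2 q.2) = 0.
    apply: zg_eqP => s; rewrite -[of_ s]zg_barK zg_bar_of.
    rewrite mulr0 raddf0 zg_bar_of -(tensor_lift_actr hL hM).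
    exact: (gtensor_form0 hL hM).
  rewrite -[zg_act 0 _]/(additive_of (zg_actl_is_additive hL _) 0) raddf0.
  by rewrite -[LHS]/(additive_of (tensl_is_additive cG ou _) 0) raddf0.
- by move=> s a b; exact: (raddfD (additive_of (aB s)) a b).
- apply: tensor_additive_eq => [a b|//|x v]; first exact: aB.
  by rewrite (glact_tens cG ou hL) (glact1 hL).
- move=> s t; apply: tensor_additive_eq => [a b|a b|x v]; first exact: aB.
    by rewrite !aB.
  by rewrite !(glact_tens cG ou hL) (glactM hL).
- move=> s a b; rewrite !gtensor_formE (tensor_lift_actl hL hM).
  by rewrite (tensor_lift_actr hL hM) mulrA -zg_ofM mulgV zg_of1 mul1r.
- apply: tensor_additive_eq => [a b|a b|x v]; first exact: aB.
    by rewrite opprB opprK addrC.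
  rewrite (glact_tens cG ou hL) (glact_u hL).
  by rewrite -[LHS]/(additive_of (tensl_is_additive cG ou _) _) raddfN.
Qed.

Let hT := gtensor_is_glattice.

(** A lifted product is determined by its trace form and linearity over G, so the one that defined
    the form is recovered from it. *)
Lemma lift_form_gtensor (a b : GT) : lift a b = tlift a b.
Proof.
apply: zg_eqP => s; rewrite (zg_t_of_lift_form cG ou hT) gtensor_formE.
by rewrite (tensor_lift_actl hL hM).
Qed.

Lemma zg_act_tens r x v : zg_act r (tens x v : GT) = tens (zg_act r x) v.
Proof.
move: r; apply: zg_additive_eq => [r r'|r r'|s].
- exact: (zg_actl_is_additive hT).
- by rewrite (zg_actl_is_additive hL x) (tensl_is_additive cG ou v).
- by rewrite (zg_act_of cG ou hT) (zg_act_of cG ou hL) (glact_tens cG ou hL).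
Qed.

Lemma gtensor_invertible : invertible u GT.
Proof.
apply: (invertible_of_local (cG := cG) (ou := ou) hT) => m m0.
have [e [y [eP [r yE]]]] := invertible_local cG ou iL m0.
have [f [w [fP [q wE]]]] := invertible_local cG ou iM m0.
exists (tens e f), (tens y w); split; last first.
  exists (r + q + r * q *+ m); rewrite lift_form_gtensor (tensor_lift_tens cG ou hL hM).
  rewrite yE wE mulrDl mul1r mulrDr mulr1 !mulrnDl mulrnAl mulrnAr -!addrA.
  by congr (_ + _); rewrite addrCA.
apply: tensor_ind => [|a b [r1 [a1 ->]] [r2 [a2 ->]]|x v].
- exists 0, 0; rewrite mul0rn addr0.
  by rewrite -[zg_act 0 _]/(additive_of (zg_actl_is_additive hT _) 0) raddf0.
- exists (r1 + r2), (a1 + a2); rewrite mulrnDl addrACA; congr (_ + _).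
  by rewrite -[RHS]/(additive_of (zg_actl_is_additive hT _) _) raddfD.
have [[r1 [x1 ->]] [r2 [v1 ->]]] := (eP x, fP v).
exists (r2 * r1), (tens x1 (zg_act r2 f + v1 *+ m) + tens (zg_act r1 e) v1).
rewrite zg_act_tens (zg_actM hL) tensZ tensDl !pmulrn tensMzl.
by rewrite [in tens (zg_act r1 e) _]tensDr tensMzr mulrzDl -addrA
           [_ *~ m + _]addrC.
Qed.

End TensorInvertible.

(** * The standard lattice and the conjugate lattice *)

Section UnitAndInverse.
Variables (gT : finGroupType) (cG : abelian [set: gT]).
Variables (u : gT) (ou : #[u]%g = 2%N).
Local Notation A := (zg cG ou).
Local Notation ZL := (zg_lattice cG ou).
Local Notation of_ := (zg_of cG ou).
Local Notation sg := (sg ou).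
Local Notation n := #|gT|./2.
Local Notation lift := (lift_form cG ou).

Lemma zg_form_gt0 (x : A) : x != 0 -> 0 < zg_t (x * zg_bar x).
Proof.
move=> x0; pose c i := zg_t (of_ (sg i)^-1 * x).
have -> : zg_t (x * zg_bar x) = \sum_i c i ^+ 2.
  rewrite {1}[x]zg_expand mulr_suml raddf_sum; apply: eq_bigr => i _.
  have -> : of_ (sg i) = zg_bar (of_ (sg i)^-1) by rewrite zg_bar_of invgK.
  by rewrite mulrzAl raddfMz /= -zg_barM zg_t_bar mulrzz.
rewrite lt_def sumr_ge0 ?andbT => [|i _]; last exact: sqr_ge0.
apply: contraNneq x0 => /psumr_eq0P c0.
rewrite [x]zg_expand big1 // => i _.
have /eqP := c0 (fun i _ => sqr_ge0 (c i)) i isT.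
by rewrite sqrf_eq0 => /eqP; rewrite /c => ->; rewrite mulr0z.
Qed.

Lemma zg_is_glattice : is_glattice u ZL.
Proof.
split=> /=.
- exact: zg_fin_gen.
- by move=> x y z; rewrite mulrDl raddfD.
- by move=> x y z; rewrite raddfD mulrDr raddfD.
- by move=> x y; rewrite -[LHS]zg_t_bar zg_barM zg_barK mulrC.
- exact: zg_form_gt0.
- by move=> s x y; rewrite mulrDr.
- by move=> x; rewrite zg_of1 mul1r.
- by move=> s t x; rewrite zg_ofM mulrA.
- move=> s x y; rewrite zg_barM mulrACA zg_bar_of -zg_ofM mulgV.
  by rewrite zg_of1 mul1r.
- by move=> x; rewrite zg_of_u mulN1r.
Qed.

Lemma zg_act_zg (r : A) (x : ZL) : zg_act r x = r * x.
Proof.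
move: r; apply: zg_additive_eq => [r r'|r r'|s].
- exact: (zg_actl_is_additive zg_is_glattice).
- by rewrite mulrBl.
- exact: (zg_act_of cG ou zg_is_glattice).
Qed.

Lemma lift_form_zg (x y : ZL) : lift x y = x * zg_bar y.
Proof.
apply: zg_eqP => s; rewrite (zg_t_of_lift_form cG ou zg_is_glattice) /=.
by rewrite mulrA.
Qed.

Lemma zg_invertible : invertible u ZL.
Proof.
split; first exact: zg_is_glattice.
  exists (fun i => of_ (sg i)); split; first exact: zbasis_zg.
  rewrite (_ : gram _ = 1%:M) ?det1 //; apply/matrixP => i j; rewrite !mxE /=.
  by rewrite zg_bar_of mulrC zg_t_sg eq_sym.
move=> m _; exists 1; apply/(gen_modP cG ou zg_is_glattice) => x.
by exists x, 0; rewrite zg_act_zg mulr1 mul0rn addr0.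
Qed.

Variables (L : gdata gT).

Lemma gbar_is_glattice : is_glattice u L -> is_glattice u (gbar L).
Proof.
move=> hL; split=> /=.
- exact: (glat_fin_gen hL).
- exact: (glformDl hL).
- exact: (glformDr hL).
- exact: (glform_sym hL).
- exact: (glform_gt0 hL).
- by move=> s; apply: (glactD hL).
- by move=> x; rewrite invg1; apply: (glact1 hL).
- by move=> s t x; rewrite invMg (abelian_mulgC cG) (glactM hL).
- by move=> s; apply: (glact_isom hL).
- by move=> x; rewrite (invgu ou); apply: (glact_u hL).
Qed.

Lemma gbar_invertible : invertible u L -> invertible u (gbar L).
Proof.
case=> hL bL gL; split=> //; first exact: gbar_is_glattice.
move=> m /gL[e eP]; exists e => x; have [c [y ->]] := eP x.
exists [ffun s => c s^-1%g], y; congr (_ + _).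
rewrite /lincomb (reindex_inj invg_inj); apply: eq_bigr => s _ /=.
by rewrite ffunE.
Qed.

Variable hL : is_glattice u L.

(** Inverting the action moves group elements to the other argument of the form. *)
Lemma lift_form_gbar (x y : L) : lift (x : gbar L) (y : gbar L) = lift y x.
Proof.
apply: zg_eqP => s.
rewrite (zg_t_of_lift_form cG ou (gbar_is_glattice hL)) /=.
rewrite (zg_t_of_lift_form cG ou hL) (glform_actV hL).
exact: (glform_sym hL).
Qed.

Lemma zg_act_gbar (r : A) (x : L) : zg_act r (x : gbar L) = zg_act (zg_bar r) x.
Proof.
move: r; apply: zg_additive_eq => [r r'|r r'|s].
- exact: (zg_actl_is_additive (gbar_is_glattice hL)).
- by rewrite raddfB (zg_actl_is_additive hL x).
- by rewrite zg_bar_of (zg_act_of cG ou (gbar_is_glattice hL)) (zg_act_of cG ou hL).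
Qed.

End UnitAndInverse.

(** * The isomorphisms behind the group axioms *)

Section Isomorphisms.
Variables (gT : finGroupType) (cG : abelian [set: gT]).
Variables (u : gT) (ou : #[u]%g = 2%N).
Local Notation A := (zg cG ou).
Local Notation lift := (lift_form cG ou).
Local Notation "L *t M" := (gtensor cG ou L M) (at level 40, left associativity).
Local Notation tens := (tens cG ou).
Implicit Types L M N : gdata gT.

(* A form-preserving map is injective because the form is definite. *)
Lemma giso_of_surj L M (hL : is_glattice u L) (hM : is_glattice u M)
    (f : {additive L -> M}) :
  (forall x y, glform (f x) (f y) = glform x y) ->
  (forall s x, f (glact s x) = glact s (f x)) ->
  (forall y, exists x, f x = y) -> giso L M.
Proof.
move=> fE fA /choice[g gK]; exists f; split=> //; exists g => // x.
apply/eqP; rewrite -subr_eq0; apply/negPn/negP => /(glform_gt0 hL).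
by rewrite -fE raddfB gK subrr (glform0l hM) ltxx.
Qed.

(** The hypothesis is about lifted forms because only these are multiplicative on pure tensors;
    isometry follows by biadditivity and taking traces. *)
Lemma gtensor_giso L M N (iL : invertible u L) (iM : invertible u M)
    (hN : is_glattice u N) (f : {additive tensor cG ou L M -> N}) :
  (forall x y v w,
     lift (f (tens x v)) (f (tens y w)) = lift x y * lift v w) ->
  (forall s x v, f (tens (glact s x) v) = glact s (f (tens x v))) ->
  (forall z, exists a, f a = z) -> giso (L *t M) N.
Proof.
have [[hL _ _] [hM _ _]] := (iL, iM).
move=> fE fA fS; apply: (@giso_of_surj (L *t M) N) fS => //.
- exact: gtensor_is_glattice.
- move=> a b; rewrite gtensor_formE -(zg_t_lift_form cG ou hN); congr zg_t.
  move: a; apply: tensor_additive_eq => [a a'|a a'|x v].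
  + by rewrite raddfB (lift_forml_is_additive cG ou hN).
  + exact: (tensor_liftl_is_additive hL hM).
  move: b; apply: tensor_additive_eq => [b b'|b b'|y w].
  + by rewrite raddfB (lift_formr_is_additive cG ou hN).
  + exact: (tensor_liftr_is_additive hL hM).
  by rewrite (tensor_lift_tens cG ou hL hM).
- move=> s; apply: tensor_additive_eq => [a a'|a a'|x v].
  + by rewrite (gtensor_act_is_additive hL) raddfB.
  + by rewrite raddfB (glact_is_additive hN).
  by rewrite (glact_tens cG ou hL) fA.
Qed.

Lemma gtensor_surj L M (V : zmodType) (f : {additive V -> tensor cG ou L M}) :
  (forall x v, exists a, f a = tens x v) -> forall z, exists a, f a = z.
Proof.
move=> fS; apply: tensor_ind => // [|a b [a' <-] [b' <-]].
  by exists 0; rewrite raddf0.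
by exists (a' + b'); rewrite raddfD.
Qed.

Lemma gtensorC L M : invertible u L -> invertible u M -> giso (L *t M) (M *t L).
Proof.
move=> iL iM; have [[hL _ _] [hM _ _]] := (iL, iM).
have [|||f fE] := @tensor_universal _ cG u ou L M (tensor cG ou M L)
                    (fun x v => tens v x).
- by move=> v x y; apply: tensr_is_additive.
- by move=> x v w; apply: tensl_is_additive.
- by move=> r x v; rewrite tensZ.
apply: (@gtensor_giso _ _ (M *t L) _ _ _ f) => //.
- exact: gtensor_is_glattice.
- move=> x y v w; rewrite !fE (lift_form_gtensor iM iL).
  by rewrite (tensor_lift_tens cG ou hM hL) mulrC.
(* The action is defined on the left factor; it crosses to the right one as a Z<G>-scalar. *)
- move=> s x v; rewrite !fE (glact_tens cG ou hM).
  by rewrite -!(zg_act_of cG ou) // -tensZ.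
- by apply: gtensor_surj => v x; exists (tens x v).
Qed.

Lemma gtensor_congr L L' M M' :
  invertible u L -> invertible u L' -> invertible u M -> invertible u M' ->
  giso L L' -> giso M M' -> giso (L *t M) (L' *t M').
Proof.
move=> iL iL' iM iM' [f [[f' fK fK'] fE fA]] [g [[g' gK gK'] gE gA]].
have [[hL _ _] [hM _ _]] := (iL, iM).
have [[hL' _ _] [hM' _ _]] := (iL', iM').
have actf N N' (h : {additive N -> N'}) (r : A) x :
    (forall s x, h (glact s x) = glact s (h x)) ->
    h (zg_act r x) = zg_act r (h x).
  by move=> hA; rewrite raddf_sum; apply: eq_bigr => s _; rewrite raddfMz /= hA.
have liftf N N' (h : {additive N -> N'}) x y :
    (forall x y, glform (h x) (h y) = glform x y) ->
    (forall s x, h (glact s x) = glact s (h x)) ->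
    lift (h x) (h y) = lift x y.
  by move=> hE hA; apply: eq_bigr => s _; rewrite -hA hE.
have [|||t tE] := @tensor_universal _ cG u ou L M (tensor cG ou L' M')
                    (fun x v => tens (f x) (g v)).
- by move=> v x y; rewrite raddfB; apply: tensl_is_additive.
- by move=> x v w; rewrite raddfB; apply: tensr_is_additive.
- by move=> r x v; rewrite !actf // tensZ.
apply: (@gtensor_giso _ _ (L' *t M') _ _ _ t) => //.
- exact: gtensor_is_glattice.
- move=> x y v w; rewrite !tE (lift_form_gtensor iL' iM').
  by rewrite (tensor_lift_tens cG ou hL' hM') !liftf.
- by move=> s x v; rewrite !tE (glact_tens cG ou hL') fA.
- by apply: gtensor_surj => x v; exists (tens (f' x) (g' v)); rewrite tE fK' gK'.
Qed.

Lemma gbar_congr L M : giso L M -> giso (gbar L) (gbar M).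
Proof. by case=> f [fB fE fA]; exists f; split=> // s x; apply: fA. Qed.

Lemma gtensor1l L : invertible u L -> giso (zg_lattice cG ou *t L) L.
Proof.
move=> iL; have [hL _ _] := iL.
have [|||f fE] := @tensor_universal _ cG u ou (zg_lattice cG ou) L L
                    (fun r x => zg_act (r : A) x).
- by move=> x; apply: zg_actl_is_additive.
- by move=> r; apply: zg_act_is_additive.
- by move=> r r' x; rewrite zg_act_zg mulrC (zg_actM hL).
apply: (@gtensor_giso _ _ L _ _ _ f) => //.
- exact: zg_invertible.
- move=> r r' x y; rewrite !fE (lift_form_zgl hL) (lift_form_zgr hL).
  by rewrite lift_form_zg mulrA.
- by move=> s r x; rewrite !fE /= (zg_actM hL) (zg_act_of cG ou hL).
- by move=> x; exists (tens (1 : zg_lattice cG ou) x); rewrite fE (zg_act1 cG ou hL).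
Qed.

(** Evaluation [\bar x (x) y -> y . \bar x] is balanced since conjugation undoes the twisted action,
    and onto by the partition of unity. *)
Lemma gtensorVl L : invertible u L -> giso (gbar L *t L) (zg_lattice cG ou).
Proof.
move=> iL; have [hL _ _] := iL.
have [|||f fE] := @tensor_universal _ cG u ou (gbar L) L (zg_lattice cG ou)
                    (fun x y => @lift_form _ cG u ou L y x).
- by move=> y; exact: (lift_formr_is_additive cG ou hL y).
- by move=> x; exact: (lift_forml_is_additive cG ou hL x).
- move=> r x y; rewrite (zg_act_gbar hL) (lift_form_zgr hL).
  by rewrite (lift_form_zgl hL) zg_barK.
apply: (@gtensor_giso _ _ (zg_lattice cG ou) _ _ _ f) => //.
- exact: gbar_invertible.
- exact: zg_is_glattice.
(* The claim is [(y . \bar x)(x' . \bar y') = (x' . \bar x)(y . \bar y')], the rank one identity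
   paired with [y']. *)
- move=> x x' y y'; rewrite !fE lift_form_zg (lift_form_gbar cG ou hL).
  rewrite (zg_bar_lift_form cG ou hL) -!(lift_form_zgl hL).
  by rewrite (lift_form_swap cG ou iL).
- move=> s x y; rewrite !fE /= (lift_form_actr cG ou hL).
  by rewrite invgK.
- move=> r; have [s sE] := lift_form_partition_of_unity cG ou iL.
  exists (\sum_(p <- s) tens (p.2 : gbar L) (zg_act r p.1)).
  rewrite raddf_sum -[RHS]mulr1 -sE mulr_sumr; apply: eq_bigr => p _ /=.
  by rewrite fE (lift_form_zgl hL).
Qed.

Lemma gtensorA L M N : invertible u L -> invertible u M -> invertible u N ->
  giso (L *t M *t N) (L *t (M *t N)).
Proof.
move=> iL iM iN; have [[hL _ _] [hM _ _] [hN _ _]] := And3 iL iM iN.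
have iLM := gtensor_invertible cG ou iL iM.
have iMN := gtensor_invertible cG ou iM iN.
have [[hLM _ _] [hMN _ _]] := (iLM, iMN).
have hR := gtensor_is_glattice cG ou iL iMN.
(* The trilinear map is built in two stages: for each fixed [w] a map on L (x) M, then additivity
   and balance in [w] checked on pure tensors. *)
have /choice[g gE] : forall w : N,
    exists g : {additive tensor cG ou L M -> tensor cG ou L (M *t N)},
    forall x v, g (tens x v) = tens x (tens v w : M *t N).
  move=> w; apply: tensor_universal.
  - by move=> v; apply: tensl_is_additive.
  - move=> x v v'; rewrite (tensl_is_additive cG ou w).
    exact: tensr_is_additive.
  - by move=> r x v; rewrite tensZ (zg_act_tens iM iN).
have [|||f fE] := @tensor_universal _ cG u ou (L *t M) N
   (tensor cG ou L (M *t N)) (fun a w => g w a).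
- by move=> w a b; rewrite raddfB.
- move=> a w w'; move: a; apply: tensor_additive_eq => [a b|a b|x v].
  + by rewrite raddfB.
  + by rewrite (raddfB (g w)) (raddfB (g w')) !opprD !opprK addrACA.
  + by rewrite !gE (tensr_is_additive cG ou v) (tensr_is_additive cG ou x).
- move=> r a w; move: a; apply: tensor_additive_eq => [a b|a b|x v].
  + by rewrite (zg_act_is_additive hLM) raddfB.
  + by rewrite raddfB.
  + by rewrite (zg_act_tens iL iM) !gE tensZ (zg_act_tens iM iN) tensZ.
apply: (@gtensor_giso _ _ (L *t (M *t N)) _ _ _ f) => //.
- move=> a b w w'; rewrite !fE (lift_form_gtensor iL iM).
  move: a; apply: tensor_additive_eq => [a a'|a a'|x v].
  + by rewrite raddfB (lift_forml_is_additive cG ou hR).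
  + by rewrite (tensor_liftl_is_additive hL hM) mulrBl.
  move: b; apply: tensor_additive_eq => [b b'|b b'|y v'].
  + by rewrite raddfB (lift_formr_is_additive cG ou hR).
  + by rewrite (tensor_liftr_is_additive hL hM) mulrBl.
  rewrite !gE (lift_form_gtensor iL iMN) (tensor_lift_tens cG ou hL hMN).
  rewrite (lift_form_gtensor iM iN) (tensor_lift_tens cG ou hM hN).
  by rewrite (tensor_lift_tens cG ou hL hM) mulrA.
- move=> s a w; rewrite !fE.
  move: a; apply: tensor_additive_eq => [a a'|a a'|x v].
  + by rewrite (glact_is_additive hLM) raddfB.
  + by rewrite raddfB (glact_is_additive hR).
  by rewrite (glact_tens cG ou hL) !gE (glact_tens cG ou hL).
- apply: gtensor_surj => x b; move: b; apply: tensor_ind.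
  + exists 0; rewrite raddf0.
    exact/esym/(raddf0 (additive_of (tensr_is_additive cG ou x))).
  + move=> b b' [a aE] [a' aE']; exists (a + a').
    by rewrite raddfD /= aE aE' -tensDr.
  + by move=> v w; exists (tens (tens x v : L *t M) w); rewrite fE gE.
Qed.

End Isomorphisms.

(** * The group law on isomorphism classes *)

Section Representatives.
Variables (gT : finGroupType) (u : gT).

Definition wrepr (C : WPic u) : invglat u := sval (cid (svalP C)).

Lemma wreprK (C : WPic u) : wclass (iglatP (wrepr C)) = C.
Proof.
case: C => C exC; apply: eq_exist; rewrite /wrepr /=.
by case: cid => /= L ->; case: L.
Qed.

Lemma giso_wrepr (L : gdata gT) (iL : invertible u L) : giso (wrepr (wclass iL)) L.
Proof. by apply/(wclass_eqP (iglatP _) iL); rewrite wreprK. Qed.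

End Representatives.

Theorem theorem14p2 (gT : finGroupType) (cG : abelian [set: gT])
    (u : gT) (ou : #[u]%g = 2%N) :
  exists (inv1 : invertible u (zg_lattice cG ou))
         (invT : forall L M : gdata gT, invertible u L -> invertible u M ->
                   invertible u (gtensor cG ou L M))
         (invB : forall L : gdata gT, invertible u L -> invertible u (gbar L))
         (mul : WPic u -> WPic u -> WPic u) (inv : WPic u -> WPic u),
    [/\ associative mul, commutative mul,
        left_id (wclass inv1) mul & left_inverse (wclass inv1) inv mul] /\
    (forall (L M : gdata gT) (iL : invertible u L) (iM : invertible u M),
       mul (wclass iL) (wclass iM) = wclass (invT L M iL iM)) /\
    (forall (L : gdata gT) (iL : invertible u L),
       inv (wclass iL) = wclass (invB L iL)).
Proof.
exists (zg_invertible cG ou), (@gtensor_invertible _ cG _ ou).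
exists (fun L => @gbar_invertible _ cG _ ou L).
pose mul (C D : WPic u) : WPic u :=
  wclass (gtensor_invertible cG ou (iglatP (wrepr C)) (iglatP (wrepr D))).
pose inv (C : WPic u) : WPic u :=
  wclass (gbar_invertible cG ou (iglatP (wrepr C))).
(* The product is formed from chosen representatives; [gtensor_congr] removes the choice. *)
have mulE L M (iL : invertible u L) (iM : invertible u M) :
    mul (wclass iL) (wclass iM) = wclass (gtensor_invertible cG ou iL iM).
  apply/wclass_eqP; apply: gtensor_congr => //;
    by [apply: iglatP | apply: giso_wrepr].
have invE L (iL : invertible u L) : inv (wclass iL) = wclass (gbar_invertible cG ou iL).
  exact/wclass_eqP/gbar_congr/giso_wrepr.
exists mul, inv; split; last by split.
split=> [C D E|C D|C|C].
- rewrite -[C]wreprK -[D]wreprK -[E]wreprK !mulE; apply/wclass_eqP/giso_sym.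
  by apply: gtensorA; apply: iglatP.
- rewrite -[C]wreprK -[D]wreprK !mulE; apply/wclass_eqP.
  by apply: gtensorC; apply: iglatP.
- rewrite -[C]wreprK mulE; apply/wclass_eqP/gtensor1l/iglatP.
- rewrite -[C]wreprK invE mulE; apply/wclass_eqP/gtensorVl/iglatP.
Qed.
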